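(* Let $n\ge 2$, $\theta\in(0,\pi)$, and let $\Sigma\subset\overline{\mathbb{B}}^{n+1}$ be a smooth, properly embedded, orientable hypersurface with $\theta$-capillary boundary, given by the embedding $x:\overline{\mathbb{B}}^n\to\overline{\mathbb{B}}^{n+1}$. Let $e\in\mathbb{R}^{n+1}$ be a constant unit vector and $X_e:=\langle x,e\rangle x-\frac12(|x|^2+1)e$. Then for $1\le k\le n$, $$\int_\Sigma H_{k-1}\big(\langle x,e\rangle+\cos\theta\,\langle\nu,e\rangle\big)\,dA=\int_\Sigma H_k\,\langle X_e,\nu\rangle\,dA.$$
   Context: $\mathbb{B}^{m}$ is the open unit ball of $\mathbb{R}^m$ centred at the origin, $\mathbb{S}^n=\partial\mathbb{B}^{n+1}$, with outward unit normal $\overline N(x)=x$; $D$ is the Euclidean connection. A hypersurface $\Sigma\subset\overline{\mathbb{B}}^{n+1}$ given by a smooth embedding $x:\overline{\mathbb{B}}^n\to\overline{\mathbb{B}}^{n+1}$ is properly embedded if $x(\mathbb{B}^n)\subset\mathbb{B}^{n+1}$ and $\partial\Sigma=x(\partial\mathbb{B}^n)\subset\mathbb{S}^n$. With $\nu$ a unit normal field of $\Sigma$, the second fundamental form is $h(X,Y)=-\langle D_XY,\nu\rangle$. $\Sigma$ has $\theta$-capillary boundary if $\langle\nu,\overline N\circ x\rangle=-\cos\theta$ along $\partial\mathbb{B}^n$. $\sigma_k$ is the $k$-th elementary symmetric polynomial of the principal curvatures (eigenvalues of $h$ with respect to the induced metric) and $H_k=\binom nk^{-1}\sigma_k$, $H_0=1$.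 *)

(* Defs.v *)
From HB Require Import structures.
From mathcomp Require Import all_boot all_order all_algebra.
From mathcomp Require Import all_classical all_reals all_analysis.
(* Not imported: the notations of [mpoly] clash with those of analysis. *)
From mathcomp Require mpoly.
Import Order.TTheory GRing.Theory Num.Theory.
Import numFieldNormedType.Exports.

Set Implicit Arguments.
Unset Strict Implicit.
Unset Printing Implicit Defensive.

Local Open Scope classical_set_scope.
Local Open Scope ring_scope.

Section euclidean.
Context {R : realType} {m : nat}.

Definition dot (u v : 'rV[R]_m) : R := (u *m v^T) 0 0.

(* The library norm `|u| on 'rV[R]_m is the sup norm. *)
Definition enorm (u : 'rV[R]_m) : R := Num.sqrt (dot u u).

End euclidean.

Definition unit_ball (R : realType) (m : nat) : set 'rV[R]_m :=
  [set u | enorm u < 1].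
Definition closed_unit_ball (R : realType) (m : nat) : set 'rV[R]_m :=
  [set u | enorm u <= 1].
Definition unit_sphere (R : realType) (m : nat) : set 'rV[R]_m :=
  [set u | enorm u = 1].
Arguments unit_ball : clear implicits.
Arguments closed_unit_ball : clear implicits.
Arguments unit_sphere : clear implicits.

(* n-dimensional Lebesgue measure, carried by n-tuples because the library
   puts no sigma-algebra on row vectors: [leb n.+1] is the product of
   [lebesgue_measure] on the head with [leb n] on the tail. *)
Section lebesgue.
Context {R : realType}.

Local Notation T n := (n.-tuple (measurableTypeR R)).

Definition cons_pair n (p : measurableTypeR R * T n) : T n.+1 :=
  [tuple of p.1 :: p.2].

Lemma measurable_cons_pair n :
  measurable_fun [set: measurableTypeR R * T n] (@cons_pair n).
Proof. by apply: measurable_cons. Qed.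

Section step.
Variables (n : nat) (mu : {measure set (T n) -> \bar R}).
Let mf := @measurable_cons_pair n.

Definition leb_step : set (T n.+1) -> \bar R :=
  pushforward (@lebesgue_measure R \x^ mu)%E (@cons_pair n).

Let leb_step0 : leb_step set0 = 0%E.
Proof. exact: measure0. Qed.

Let leb_step_ge0 A : (0 <= leb_step A)%E.
Proof. exact: measure_ge0. Qed.

Let leb_step_sigma_additive : semi_sigma_additive leb_step.
Proof.
by apply: measure_semi_sigma_additive; exact: measurable_cons_pair.
Qed.

HB.instance Definition _ := isMeasure.Build _ _ _ leb_step
  leb_step0 leb_step_ge0 leb_step_sigma_additive.

End step.

Fixpoint leb (n : nat) : {measure set (T n) -> \bar R} :=
  match n return {measure set (T n) -> \bar R} with
  | 0 => dirac ([tuple] : T 0)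
  | n'.+1 => leb_step (leb n')
  end.

End lebesgue.

Section hypersurface.
Context {R : realType} {n : nat}.

Definition partial m (i : 'I_n) (f : 'rV[R]_n -> 'rV[R]_m) :
  'rV[R]_n -> 'rV[R]_m := 'D_(delta_mx 0 i) f.

(* C^oo on U: every iterated partial derivative is differentiable on U (hence
   continuous there). *)
Definition smooth_on m (U : set 'rV[R]_n) (f : 'rV[R]_n -> 'rV[R]_m) : Prop :=
  forall (s : seq 'I_n) u, U u -> differentiable (foldr (@partial m) f s) u.

(* A smooth map on the closed ball is represented by a total function that is
   smooth on an open neighbourhood of the ball; its derivatives at points of
   the closed ball, boundary included, depend only on its values there. *)
Definition smooth_on_ball m (f : 'rV[R]_n -> 'rV[R]_m) : Prop :=
  exists2 U : set 'rV[R]_n,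
    open U & closed_unit_ball R n `<=` U /\ smooth_on U f.

Variables (x nu : 'rV[R]_n -> 'rV[R]_n.+1).

(* An immersion that is a homeomorphism onto its image. *)
Definition smooth_embedding : Prop :=
  [/\ smooth_on_ball x,
      forall u, closed_unit_ball R n u -> \rank (jacobian x u) = n
    & exists2 y : 'rV[R]_n.+1 -> 'rV[R]_n,
        {within x @` closed_unit_ball R n, continuous y} &
        forall u, closed_unit_ball R n u -> y (x u) = u].

Definition properly_embedded : Prop :=
  [/\ smooth_embedding,
      x @` unit_ball R n `<=` unit_ball R n.+1
    & x @` unit_sphere R n `<=` unit_sphere R n.+1].

Definition unit_normal_field : Prop :=
  smooth_on_ball nu /\
  forall u, closed_unit_ball R n u ->
    enorm (nu u) = 1 /\ forall v, dot (nu u) ('D_v x u) = 0.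

(* The outward unit normal of the unit sphere at p is p itself. *)
Definition capillary_boundary (theta : R) : Prop :=
  forall u, unit_sphere R n u -> dot (nu u) (x u) = - cos theta.

Definition metric (u : 'rV[R]_n) : 'M[R]_n :=
  \matrix_(i, j) dot (partial i x u) (partial j x u).

(* h(X, Y) = - <D_X Y, nu> in the coordinate frame. *)
Definition second_fundamental_form (u : 'rV[R]_n) : 'M[R]_n :=
  \matrix_(i, j) - dot (partial i (partial j x) u) (nu u).

(* v *m h = a *: (v *m g) iff v is an eigenvector of h *m g^-1 for a. *)
Definition shape_operator (u : 'rV[R]_n) : 'M[R]_n :=
  second_fundamental_form u *m invmx (metric u).

(* Eigenvalues with multiplicity; they are all real because h is symmetric and
   g is positive definite, and their order is irrelevant below. *)
Definition principal_curvatures (u : 'rV[R]_n) : 'rV[R]_n :=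
  xget 0 [set kappa : 'rV[R]_n |
    char_poly (shape_operator u) = \prod_(i < n) ('X - (kappa 0 i)%:P)].

Definition sigma (k : nat) (u : 'rV[R]_n) : R :=
  mpoly.meval (fun i => principal_curvatures u 0 i) (mpoly.mesym n R k).

Definition mean_curvature (k : nat) (u : 'rV[R]_n) : R :=
  sigma k u / 'C(n, k)%:R.

(* Integral over the hypersurface of the function f, pulled back to the closed
   ball; dA = sqrt (det g) du. *)
Definition surface_integral (f : 'rV[R]_n -> R) : R :=
  \int[leb n]_(t in [set t : n.-tuple R |
                      closed_unit_ball R n (\row_i tnth t i)])
    (f (\row_i tnth t i) * Num.sqrt (\det (metric (\row_i tnth t i)))).

End hypersurface.

Definition conformal_field {R : realType} {m : nat} (e p : 'rV[R]_m) :
    'rV[R]_m :=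
  dot p e *: p - (2^-1 * (enorm p ^+ 2 + 1)) *: e.

(* Main.v *)
(** The proof uses a tangential vector field with vanishing flux through the
    boundary.  Let c = cos theta, x_i, nu_i the partial derivatives of x and nu,
    and F = X_e + c (<nu, e> x - <x, nu> e).  For a real parameter t put
    W^i = det (nu, x_1 + t nu_1, .., F, .., x_n + t nu_n), with F in the i-th
    tangential slot.  In the divergence of W the second derivatives of x + t nu
    cancel in pairs, by symmetry of second partial derivatives and antisymmetry
    of the determinant; this plays the role of the divergence-free Newton
    tensors.  With q(t) = det (nu, x_1 + t nu_1, .., x_n + t nu_n)
    = +- sqrt(det g) sum_k sigma_k t^k, what remains is
    (<x, e> + c <nu, e>) (n q - t q') - <X_e, nu> q'; the derivative of F also
    contributes the skew map v |-> <v, e> x - <v, x> e, which disappears because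
    the second fundamental form is symmetric.  On the sphere x + c nu is
    orthogonal to F and to the derivatives of x and of nu along the sphere, so
    sum_i u_i W^i = 0.  The divergence theorem for fields with zero boundary flux
    follows from Fubini and the fundamental theorem of calculus applied to
    (1 - |u|^(2m)) W as m tends to infinity.  The coefficient of t^(k-1) is
    the claim, since (n - k + 1) binom(n, k - 1) = k binom(n, k). *)

From HB Require Import structures.
Require Import Defs.
From mathcomp Require Import all_boot all_order all_algebra.
From mathcomp Require Import all_classical all_reals all_analysis.
From mathcomp Require mpoly.
Import (canonicals) mpoly.
From mathcomp Require Import complex.
From mathcomp Require Import perm measurable_realfun.
From mathcomp Require Import ring lra.
Import Order.TTheory GRing.Theory Num.Theory.
Import numFieldNormedType.Exports.

Set Implicit Arguments.
Unset Strict Implicit.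
Unset Printing Implicit Defensive.

Local Open Scope classical_set_scope.
Local Open Scope ring_scope.

(** * Determinants with a replaced row *)

(** The parameter t is that of the parallel hypersurfaces x + t nu, and one vanishing integral of a
    polynomial in t yields every k at once. The obstacle is regularity: [principal_curvatures]
    chooses an ordering of the eigenvalues independently at each point, so nothing is known directly
    about the continuity of [sigma]. Differentiation and integration therefore concern only frame
    determinants and the coefficients of q, which are C1; curvature enters through the identity
    between these coefficients and [frame_det] times [sigma]. The sign in q is constant because
    every point of the ball is joined to 0 by a segment on which [frame_det] does not vanish. The
    second term of F is orthogonal to nu, so it leaves the normal component of X_e unchanged. On the
    sphere x + c nu is the tangential part of x, a conormal direction of the boundary, and the
    coefficient c is what makes F orthogonal to it. The skew term is removed by writing x_i + c nu_i
    as a combination of x_i and x_i + t nu_i, which costs t != 0; this is harmless, since a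
    polynomial that vanishes off 0 is zero. *)

Definition set_row (T : Type) (m n : nat) (A : 'M[T]_(m, n)) (i : 'I_m)
    (v : 'rV[T]_n) : 'M[T]_(m, n) :=
  \matrix_(a, b) if a == i then v 0 b else A a b.

Section set_row.
Context {R : comNzRingType} {m : nat}.
Implicit Types (A : 'M[R]_m) (v w : 'rV[R]_m) (i j : 'I_m).

Lemma row_set_row A i v : row i (set_row A i v) = v.
Proof. by apply/rowP => b; rewrite !mxE eqxx. Qed.

Lemma row_set_row_neq A i j v : j != i -> row j (set_row A i v) = row j A.
Proof. by move=> ji; apply/rowP => b; rewrite !mxE (negPf ji). Qed.

Lemma set_row_row A i : set_row A i (row i A) = A.
Proof. by apply/matrixP => a b; rewrite !mxE; case: eqP => // ->. Qed.

Lemma set_rowC A i j v w : i != j ->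
  set_row (set_row A i v) j w = set_row (set_row A j w) i v.
Proof.
move=> ij; apply/matrixP => a b; rewrite !mxE.
by case: (eqVneq a j) => // ->; rewrite eq_sym (negPf ij).
Qed.

Lemma set_row_id A i v w : set_row (set_row A i v) i w = set_row A i w.
Proof. by apply/matrixP => a b; rewrite !mxE; case: eqP. Qed.

(** Expansion along row [i], whose cofactors do not involve that row. Linearity of the determinant
    in one row is then linearity of [v *m \adj A]. *)
Lemma det_set_row A i v : \det (set_row A i v) = (v *m \adj A) 0 i.
Proof.
rewrite (expand_det_row _ i) mxE; apply: eq_bigr => j _; rewrite !mxE eqxx.
congr (_ * (_ * \det _)); apply/matrixP => a b.
by rewrite !mxE eq_sym (negPf (neq_lift i a)).
Qed.

Lemma det_set_rowD A i v w :
  \det (set_row A i (v + w)) = \det (set_row A i v) + \det (set_row A i w).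
Proof. by rewrite !det_set_row mulmxDl mxE. Qed.

Lemma det_set_rowZ A i a v :
  \det (set_row A i (a *: v)) = a * \det (set_row A i v).
Proof. by rewrite !det_set_row -scalemxAl mxE. Qed.

(** Polarisation: a repeated row gives 0, and repeating [v + w] leaves exactly the two mixed
    terms. *)
Lemma det_set_row_swap A i j v w : i != j ->
  \det (set_row (set_row A i v) j w) = - \det (set_row (set_row A i w) j v).
Proof.
move=> ij; have alt z : \det (set_row (set_row A i z) j z) = 0.
  apply: (determinant_alternate ij) => b.
  by rewrite !mxE !eqxx (negPf ij).
apply/eqP; rewrite -addr_eq0.
have := alt (v + w).
rewrite det_set_rowD !(set_rowC _ _ _ ij) !det_set_rowD.
rewrite -!(set_rowC _ _ _ ij) !alt add0r addr0 => <-.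
by rewrite addrC.
Qed.

End set_row.

Lemma det_kernel_eq0 (R : idomainType) m (A : 'M[R]_m) (p : 'cV[R]_m) :
  A *m p = 0 -> p != 0 -> \det A = 0.
Proof.
move=> Ap p0; apply/eqP; move: p0; apply: contraNT => dA.
have : \adj A *m (A *m p) = 0 by rewrite Ap mulmx0.
by rewrite mulmxA mul_adj_mx mul_scalar_mx => /eqP; rewrite scalemx_eq0 (negPf dA).
Qed.

Lemma adj_mul_det_neq0 (R : idomainType) m (A B : 'M[R]_m) :
  \det A != 0 -> \det B != 0 -> \adj (A *m B) = \adj B *m \adj A.
Proof.
move=> dA dB; apply/eqP; rewrite -subr_eq0.
have AB : A *m B *m (\adj (A *m B) - \adj B *m \adj A) = 0.
  rewrite mulmxBr mul_mx_adj mulmxA -(mulmxA A) mul_mx_adj mul_mx_scalar.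
  by rewrite -scalemxAl mul_mx_adj det_mulmx scale_scalar_mx mulrC subrr.
have : \adj (A *m B) *m (A *m B *m (\adj (A *m B) - \adj B *m \adj A)) = 0.
  by rewrite AB mulmx0.
rewrite mulmxA mul_adj_mx mul_scalar_mx det_mulmx => /eqP.
by rewrite scalemx_eq0 mulf_eq0 (negPf dA) (negPf dB).
Qed.

(* Reduction to nonzero determinants by the perturbation A + X, B + X. *)
Lemma adj_mul (R : idomainType) m (A B : 'M[R]_m) :
  \adj (A *m B) = \adj B *m \adj A.
Proof.
have ev C : map_mx (horner_eval (0 : R)) (char_poly_mx (- C)) = (C : 'M[R]_m).
  apply/matrixP => i j; rewrite !mxE /horner_eval !hornerE opprK.
  by rewrite hornerMn hornerX mul0rn add0r.
have dC C : \det (char_poly_mx (- C : 'M[R]_m)) != 0.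
  exact: monic_neq0 (char_poly_monic _).
rewrite -[A]ev -[B]ev -map_mxM -!map_mx_adj -map_mxM.
by rewrite adj_mul_det_neq0.
Qed.

Lemma mxtrace_skew_sym (R : numDomainType) m (Q Z : 'M[R]_m) :
  Q^T = - Q -> Z^T = Z -> \tr (Q *m Z) = 0.
Proof.
move=> Qs Zs; have : \tr (Q *m Z) = - \tr (Q *m Z).
  by rewrite -[LHS]mxtrace_tr trmx_mul Qs Zs mxtrace_mulC mulNmx linearN.
by move/eqP; rewrite -addr_eq0 -mulr2n mulrn_eq0 => /eqP.
Qed.

Section frame.
Context {T : Type} {n : nat}.
Implicit Types (v : 'rV[T]_n.+1) (B : 'M[T]_(n, n.+1)).

Lemma row_frame0 v B : row ord0 (col_mx v B : 'M[T]_(1 + n)) = v.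
Proof.
transitivity (row (lshift n (0 : 'I_1)) (col_mx v B)).
  by congr row; exact: val_inj.
by rewrite rowKu; apply/rowP => j; rewrite mxE.
Qed.

Lemma row_frameS v B i : row (lift ord0 i) (col_mx v B : 'M[T]_(1 + n)) = row i B.
Proof.
transitivity (row (rshift 1 i) (col_mx v B)); last by rewrite rowKd.
by congr row; exact: val_inj.
Qed.

Lemma frame_entry0 v B b : (col_mx v B : 'M[T]_(1 + n)) ord0 b = v 0 b.
Proof. by have /rowP/(_ b) := row_frame0 v B; rewrite [LHS]mxE. Qed.

Lemma frame_entryS v B (i : 'I_n) b :
  (col_mx v B : 'M[T]_(1 + n)) (lift ord0 i) b = B i b.
Proof. by have /rowP/(_ b) := row_frameS v B i; rewrite [LHS]mxE [RHS]mxE. Qed.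

End frame.

(** * Algebra of the frame at one point: [J] holds the rows x_i, [K] the rows nu_i *)

Section pointwise.
Context {R : realFieldType} {n : nat}.
Variables (J K : 'M[R]_(n, n.+1)) (nu : 'rV[R]_n.+1) (t c : R).

Local Notation M := (col_mx nu (J + t *: K) : 'M[R]_(1 + n)).
Local Notation M0 := (col_mx nu J : 'M[R]_(1 + n)).
Local Notation lift0 i := (lift ord0 i : 'I_(1 + n)).

Hypotheses (nu1 : nu *m nu^T = 1) (Jnu : J *m nu^T = 0) (Knu : K *m nu^T = 0).
Hypothesis JKs : (K *m J^T)^T = K *m J^T.

Lemma nu_neq0 : nu^T != 0.
Proof.
by apply/eqP => n0; move/matrixP/(_ 0 0)/eqP: nu1; rewrite n0 mulmx0 !mxE eqxx eq_sym oner_eq0.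
Qed.

Lemma mul_set_row k (A : 'M[R]_k) i v p :
  (forall j, j != i -> row j A *m p = 0) -> v *m p = 0 -> set_row A i v *m p = 0 :> 'cV[R]_k.
Proof.
move=> Ap vp; apply/row_matrixP => a; rewrite row_mul row0.
have [->|ai] := eqVneq a i; first by rewrite row_set_row.
by rewrite row_set_row_neq// Ap.
Qed.

(** Once its normal part is removed, [v] is orthogonal to [nu], as are all the other rows; the
    matrix then has [nu^T] in its kernel. *)
Lemma det_set_normal (A : 'M[R]_(1 + n)) v :
  (forall i, row (lift0 i) A *m nu^T = 0) ->
  \det (set_row A ord0 v) = (v *m nu^T) 0 0 * \det (set_row A ord0 nu).
Proof.
move=> An; rewrite -det_set_rowZ -[v in LHS](subrK ((v *m nu^T) 0 0 *: nu)).
rewrite det_set_rowD [X in X + _](@det_kernel_eq0 _ _ _ nu^T) ?add0r ?nu_neq0//.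
apply: mul_set_row => [j|].
  by case: (unliftP ord0 j) => [i ->//|->]; rewrite eqxx.
rewrite mulmxBl -scalemxAl nu1; apply/rowP => i.
by rewrite !mxE !ord1 eqxx mulr1 subrr.
Qed.

Lemma shifted_frame_normal i : row i (J + t *: K) *m nu^T = 0.
Proof. by rewrite -row_mul mulmxDl -scalemxAl Jnu Knu scaler0 addr0 row0. Qed.

(** Exchanging the two rows puts nu_i in its tangential slot and [F] in the normal slot, where only
    the normal component of [F] counts. These are the terms of the divergence in which the row nu is
    differentiated. *)
Lemma frame_normal_part F i :
  \det (set_row (set_row M (lift0 i) F) ord0 (row i K)) =
  - ((F *m nu^T) 0 0 * \det (set_row M (lift0 i) (row i K))).
Proof.
rewrite det_set_row_swap; last by rewrite eq_sym; exact: neq_lift.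
congr (- _); rewrite det_set_normal => [|j].
  congr (_ * \det _); rewrite set_rowC; last by rewrite eq_sym; exact: neq_lift.
  by congr set_row; rewrite -[X in set_row _ _ X](row_frame0 nu (J + t *: K)) set_row_row.
have [->|ji] := eqVneq j i; first by rewrite row_set_row -row_mul Knu row0.
rewrite row_set_row_neq; first by rewrite row_frameS shifted_frame_normal.
by rewrite (inj_eq (@lift_inj _ _)).
Qed.

Hypotheses (t0 : t != 0) (M0_neq0 : \det M0 != 0).

(** Jacobi's formula: the derivative of the determinant at [A] in direction [B], computed by rows,
    is a trace. *)
Lemma sum_det_set_row (A B : 'M[R]_(1 + n)) :
  \sum_i \det (set_row A i (row i B)) = \tr (B *m \adj A).
Proof.
by apply: eq_bigr => i _; rewrite det_set_row -row_mul mxE.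
Qed.

Variable S : 'M[R]_n.+1.
Hypothesis Sskew : S^T = - S.

(** The matrix [M *m M0^T] is block diagonal with blocks 1 and (J + t K) J^T, hence symmetric
    because K J^T is. After multiplication by [\det M0] the trace pairs the skew matrix M0 S M0^T
    with the symmetric adjugate of [M *m M0^T]. *)
Lemma frame_skew_base : \tr (M0 *m S *m \adj M) = 0.
Proof.
have Nsym : (M *m M0^T)^T = M *m M0^T.
  rewrite trmx_mul trmxK !tr_col_mx !mul_col_row nu1.
  rewrite linearD linearZ /= !mulmxDr !mulmxDl.
  rewrite -!scalemxAr -!scalemxAl.
  have -> : nu *m J^T = 0 by rewrite -[LHS]trmxK trmx_mul trmxK Jnu trmx0.
  have -> : nu *m K^T = 0 by rewrite -[LHS]trmxK trmx_mul trmxK Knu trmx0.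
  rewrite Jnu Knu !scaler0 !addr0.
  by rewrite -[J *m K^T]trmxK trmx_mul trmxK JKs.
apply: (mulfI M0_neq0); rewrite mulr0 -det_tr -mxtraceZ.
have -> : \det M0^T *: (M0 *m S *m \adj M) = M0 *m S *m M0^T *m \adj (M *m M0^T).
  by rewrite adj_mul -!mulmxA (mulmxA M0^T) mul_mx_adj mul_scalar_mx -!scalemxAr.
apply: mxtrace_skew_sym; last by rewrite trmx_adj Nsym.
by rewrite !trmx_mul trmxK Sskew -!mulmxA mulNmx mulmxN.
Qed.

Lemma skew_diag (v : 'rV[R]_n.+1) : (v *m S *m v^T) 0 0 = 0.
Proof.
have : (v *m S *m v^T)^T = - (v *m S *m v^T).
  by rewrite !trmx_mul trmxK Sskew mulNmx mulmxN mulmxA.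
move=> /matrixP/(_ 0 0)/eqP.
by rewrite !mxE -addr_eq0 -mulr2n mulrn_eq0 => /eqP.
Qed.

(** The trace has one more term, that of row 0; it is a multiple of nu S nu^T, which vanishes since
    [S] is skew. *)
Lemma sum_frame_rows (B : 'M[R]_(n, n.+1)) :
  \sum_i \det (set_row M (lift0 i) (row i (B *m S))) =
  \tr ((col_mx nu B : 'M[R]_(1 + n)) *m S *m \adj M).
Proof.
rewrite -sum_det_set_row big_ord_recl row_mul row_frame0 det_set_normal => [|i].
  rewrite skew_diag mul0r add0r; apply: eq_bigr => i _.
  by rewrite !row_mul row_frameS.
by rewrite row_frameS shifted_frame_normal.
Qed.

(** J + c K is a combination of J, covered by [frame_skew_base], and of J + t K, for which the trace
    is that of [S] times [\det M]. The coefficient c / t is the reason for t != 0. *)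
Lemma sum_frame_skew :
  \sum_i \det (set_row M (lift0 i) (row i ((J + c *: K) *m S))) = 0.
Proof.
have J0 : \sum_i \det (set_row M (lift0 i) (row i (J *m S))) = 0.
  by rewrite sum_frame_rows frame_skew_base.
have JK0 : \sum_i \det (set_row M (lift0 i) (row i ((J + t *: K) *m S))) = 0.
  rewrite sum_frame_rows mxtrace_mulC mulmxA mul_adj_mx mul_scalar_mx mxtraceZ.
  suff -> : \tr S = 0 by rewrite mulr0.
  by have := mxtrace_skew_sym Sskew (trmx1 _ n.+1); rewrite mulmx1.
have -> : J + c *: K = (1 - c / t) *: J + (c / t) *: (J + t *: K).
  rewrite scalerDr scalerA divfK// addrA -scalerDl subrK scale1r//.
under eq_bigr => i _.
  rewrite mulmxDl -!scalemxAl linearD !linearZ /= det_set_rowD !det_set_rowZ.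
  over.
by rewrite big_split/= -!mulr_sumr J0 JK0 !mulr0 addr0.
Qed.

End pointwise.

Section flux.
Context {R : idomainType} {n : nat}.
Variables (p : 'cV[R]_(1 + n)) (u : 'rV[R]_n) (F : 'rV[R]_(1 + n)).
Local Notation lift0 i := (lift ord0 i : 'I_(1 + n)).

(* Stated over an integral domain in order to be applied with polynomial
   entries: the frame nu, x_i + t nu_i may be singular for isolated t. *)
Lemma flux_eq0 (M : 'M[R]_(1 + n)) (a : R) :
  \det M != 0 -> p != 0 -> F *m p = 0 ->
  M *m p = a *: (row_mx 0 u)^T ->
  \sum_i u 0 i * \det (set_row M (lift0 i) F) = 0.
Proof.
move=> dM p0 Fp Mp.
have a0 : a != 0.
  apply: contraNneq dM => a0; apply/eqP/(det_kernel_eq0 (p := p)) => //.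
  by rewrite Mp a0 scale0r.
apply: (mulfI a0); rewrite mulr0.
(* Read through [Mp], this product is [a] times the sum; read through adj(M) M = det M, it is a
   multiple of F p, which is zero. *)
transitivity ((F *m \adj M *m (M *m p)) 0 0).
  rewrite Mp -scalemxAr mxE; congr (_ * _); rewrite mxE.
  rewrite big_ord_recl !mxE; case: splitP => // j _; rewrite mxE mulr0 add0r.
  apply: eq_bigr => i _; rewrite det_set_row mulrC !mxE; congr (_ * _).
  by case: splitP => [j0|j1] /=; [rewrite ord1|rewrite /bump add1n => -[] /val_inj ->].
by rewrite mulmxA -(mulmxA F) mul_adj_mx mul_mx_scalar -scalemxAl Fp scaler0 mxE.
Qed.

End flux.

(** * Characteristic polynomials of symmetric pencils *)

(** The nonzero points 1, ..., [size p] already outnumber the possible roots. The point 0 is left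
    out because several identities below are obtained by dividing by t. *)
Lemma poly_eq0_of_horner (R : numDomainType) (p : {poly R}) :
  (forall t : R, t != 0 -> p.[t] = 0) -> p = 0.
Proof.
move=> p0; apply/eqP; apply: contraT => pn0.
pose rs : seq R := [seq i.+1%:R | i <- iota 0 (size p)].
have urs : uniq rs.
  rewrite map_inj_uniq ?iota_uniq// => i j /eqP.
  by rewrite eqr_nat eqSS => /eqP.
have := max_poly_roots pn0 _ urs.
rewrite size_map size_iota ltnn; apply.
by apply/allP => _ /mapP[i _ ->]; apply/rootP/p0; rewrite pnatr_eq0.
Qed.

Lemma coef_prod_1DX (R : comNzRingType) n (kappa : 'rV[R]_n) k :
  (\prod_(i < n) (1 + kappa 0 i *: 'X))`_k =
  mpoly.meval (fun i => kappa 0 i) (mpoly.mesym n R k).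
Proof.
under eq_bigr do rewrite addrC.
rewrite bigA_distr coef_sum /mpoly.mesym rmorph_sum /=.
rewrite [RHS]big_mkcond; apply: eq_bigr => h _.
rewrite -big_mkcond/= scaler_prod prodr_const coefZ coefXn eq_sym.
case: eqP => _; last by rewrite mulr0.
rewrite mulr1 rmorph_prod; apply: eq_bigr => i _.
by rewrite /= mpoly.mevalXU.
Qed.

(** For t != 0, 1 + t S = (- t) (- 1/t - S), so the determinant is (- t)^n times the characteristic
    polynomial at - 1/t. *)
Lemma det_1DX_char_poly (R : numFieldType) n (S : 'M[R]_n) (kappa : 'rV[R]_n) :
  char_poly S = \prod_(i < n) ('X - (kappa 0 i)%:P) ->
  \det (1%:M + 'X *: map_mx (@polyC R) S) = \prod_(i < n) (1 + kappa 0 i *: 'X).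
Proof.
move=> cS; apply/eqP; rewrite -subr_eq0; apply/eqP/poly_eq0_of_horner => t t0.
rewrite hornerD hornerN horner_prod -horner_evalE -det_map_mx/=.
have -> : map_mx (horner_eval t) (1%:M + 'X *: map_mx (@polyC R) S) =
    (- t) *: ((- t^-1)%:M - S).
  apply/matrixP => i j; rewrite !mxE /horner_eval !hornerE mulrBr.
  by rewrite hornerMn hornerE mulrnAr mulrNN divff// mulNr opprK.
have -> : (- t^-1)%:M - S = map_mx (horner_eval (- t^-1)) (char_poly_mx S).
  by apply/matrixP => i j; rewrite !mxE /horner_eval !hornerE hornerMn hornerX.
rewrite detZ det_map_mx -/(char_poly S) cS /= /horner_eval horner_prod.
have -> : (- t) ^+ n = \prod_(i < n) (- t) by rewrite prodr_const card_ord.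
rewrite -big_split /=; apply/eqP; rewrite subr_eq0; apply/eqP.
apply: eq_bigr => i _.
by rewrite !hornerE mulrBr mulrNN divff// mulNr opprK mulrC.
Qed.

Lemma posdef_unitmx (R : realFieldType) n (g : 'M[R]_n) :
  (forall v : 'rV[R]_n, v != 0 -> 0 < (v *m g *m v^T) 0 0) -> g \in unitmx.
Proof.
move=> g_pos; rewrite -row_free_unit -kermx_eq0; apply/eqP/row_matrixP => i.
rewrite row0; apply/eqP; apply: contraT => /g_pos.
have -> : row i (kermx g) *m g = 0 by apply/eqP; rewrite -sub_kermx row_sub.
by rewrite mul0mx mxE ltxx.
Qed.

(** * Real eigenvalues of h g^-1 for h symmetric and g positive definite *)

Section real_spectrum.
Context {R : rcfType} {n : nat}.
Variables (h g : 'M[R]_n).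
Hypotheses (hs : h^T = h) (gs : g^T = g).
Hypothesis g_pos : forall v : 'rV[R]_n, v != 0 -> 0 < (v *m g *m v^T) 0 0.

Let g_unit := posdef_unitmx g_pos.

Let sym_form (A : 'M[R]_n) (a b : 'rV[R]_n) : A^T = A ->
  (a *m A *m b^T) 0 0 = (b *m A *m a^T) 0 0.
Proof.
move=> As; rewrite -[in LHS](trmxK (a *m A *m b^T)) mxE.
by rewrite !trmx_mul trmxK As mulmxA.
Qed.

(** For an eigenvector a + i b and z = p + i q, split v h = z v g into real and imaginary parts.
    Symmetry of [h] equates a h b^T with b h a^T, which leaves q (a g a^T + b g b^T) = 0, and the
    second factor is positive. *)
Lemma pencil_eigenvalue_real (z : R[i]) :
  root (map_poly (real_complex R) (char_poly (h *m invmx g))) z -> complex.Im z = 0.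
Proof.
rewrite map_char_poly -eigenvalue_root_char => /eigenvalueP[v vz v0].
pose f := real_complex R.
have hE : v *m map_mx f h = z *: (v *m map_mx f g).
  rewrite scalemxAl -vz -mulmxA -map_mxM -mulmxA (mulVmx g_unit).
  by rewrite mulmx1.
pose a : 'rV[R]_n := map_mx (@complex.Re R) v; pose b : 'rV[R]_n := map_mx (@complex.Im R) v.
have ReM (A : 'M[R]_n) j : complex.Re ((v *m map_mx f A) 0 j) = (a *m A) 0 j.
  rewrite !mxE raddf_sum; apply: eq_bigr => i _; rewrite !mxE.
  by case: (v 0 i) => p q /=; rewrite mulr0 subr0.
have ImM (A : 'M[R]_n) j : complex.Im ((v *m map_mx f A) 0 j) = (b *m A) 0 j.
  rewrite !mxE raddf_sum; apply: eq_bigr => i _; rewrite !mxE.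
  by case: (v 0 i) => p q /=; rewrite mulr0 add0r.
case: z vz hE => p q vz hE /=.
have ah : a *m h = p *: (a *m g) - q *: (b *m g).
  apply/rowP => j; move/matrixP/(_ 0 j)/(congr1 (@complex.Re R)): hE.
  rewrite ReM => ->; rewrite [in RHS]mxE [X in _ = X + _]mxE.
  rewrite [X in _ = _ + X]mxE [in X in _ = _ - X]mxE -!ReM -!ImM mxE.
  by case: (_ 0 j).
have bh : b *m h = q *: (a *m g) + p *: (b *m g).
  apply/rowP => j; move/matrixP/(_ 0 j)/(congr1 (@complex.Im R)): hE.
  rewrite ImM => ->; rewrite [in RHS]mxE [X in _ = X + _]mxE.
  rewrite [X in _ = _ + X]mxE -!ReM -!ImM mxE.
  by case: (_ 0 j) => x y /=; rewrite addrC.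
have := sym_form a b hs; rewrite ah bh mulmxBl mulmxDl -!scalemxAl.
have linB (A B : 'M[R]_1) : (p *: A - q *: B) 0 0 = p * A 0 0 - q * B 0 0.
  by rewrite !mxE.
have linD (A B : 'M[R]_1) : (q *: A + p *: B) 0 0 = q * A 0 0 + p * B 0 0.
  by rewrite !mxE.
rewrite linB linD (sym_form b a gs) => /eqP; rewrite -subr_eq0.
set ab := (a *m g *m b^T) 0 0.
set aa := (a *m g *m a^T) 0 0; set bb := (b *m g *m b^T) 0 0.
have -> : p * ab - q * bb - (q * aa + p * ab) = - (q * (aa + bb)) by ring.
rewrite oppr_eq0 mulf_eq0 => /orP[/eqP//|].
have pos (w : 'rV[R]_n) : 0 <= (w *m g *m w^T) 0 0.
  by have [->|/g_pos/ltW//] := eqVneq w 0; rewrite !mul0mx mxE.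
rewrite paddr_eq0 ?pos// => /andP[a0 b0].
have an0 : a = 0 by apply/eqP; apply: contraTT a0 => /g_pos; rewrite lt0r => /andP[].
have bn0 : b = 0 by apply/eqP; apply: contraTT b0 => /g_pos; rewrite lt0r => /andP[].
move: v0; have -> : v = 0.
  apply/rowP => i; move/rowP/(_ i): an0; move/rowP/(_ i): bn0; rewrite !mxE.
  by case: (v 0 i) => x y /= -> ->.
by rewrite eqxx.
Qed.

(** Guarantees that [xget] in [principal_curvatures] returns genuine eigenvalues and not its default
    0. *)
Lemma pencil_char_poly_split : exists kappa : 'rV[R]_n,
  char_poly (h *m invmx g) = \prod_(i < n) ('X - (kappa 0 i)%:P).
Proof.
set q := char_poly _.
pose f := real_complex R.
have [r rE] := closed_field_poly_normal (map_poly f q).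
have qm : lead_coef (map_poly f q) = 1.
  by rewrite lead_coef_map (monicP (char_poly_monic _)) rmorph1.
rewrite qm scale1r in rE.
have rreal z : z \in r -> z = f (complex.Re z).
  move=> zr; have : root (map_poly f q) z by rewrite rE root_prod_XsubC.
  by move/pencil_eigenvalue_real; case: z {zr} => x y /= ->.
have qE : q = \prod_(z <- r) ('X - (complex.Re z)%:P).
  apply: (map_poly_inj f); rewrite rE rmorph_prod.
  rewrite !big_seq; apply: eq_bigr => z zr.
  by rewrite /= rmorphB /= map_polyX map_polyC /= [in LHS](rreal _ zr).
have sr : size r = n.
  have := size_char_poly (h *m invmx g); rewrite -/q qE size_prod_XsubC.
  by case.
exists (\row_i complex.Re (r`_i)); rewrite qE (big_nth 0) sr big_mkord.
by apply: eq_bigr => i _; rewrite mxE.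
Qed.

End real_spectrum.

(** * Lebesgue measure on tuples *)

Lemma integrable_bounded_support d (T : measurableType d) (R : realType)
    (mu : {measure set T -> \bar R}) (A : set T) (f : T -> R) (b : R) :
  measurable A -> (mu A < +oo)%E -> measurable_fun setT f ->
  (forall t, `|f t| <= b) -> (forall t, ~ A t -> f t = 0) ->
  mu.-integrable setT (EFin \o f).
Proof.
move=> mA Afin mf fb f0.
have -> : EFin \o f = (EFin \o f) \_ A.
  apply/funext => t /=; rewrite patchE; case: ifPn => // /negP tA.
  by rewrite /= f0// => At; apply: tA; rewrite inE.
apply/integrable_restrict => //; rewrite setTI.
apply: measurable_bounded_integrable => //; first exact: measurable_funTS.
by exists b; split; [exact: num_real|move=> c bc t _; exact: le_trans (fb t) (ltW bc)].
Qed.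

Section lebesgue_tuple.
Context {R : realType}.
Local Notation T n := (n.-tuple (measurableTypeR R)).

Definition cube n (k : R) : set (T n) := [set t | forall i, `|tnth t i| <= k].

Arguments cube n k : clear implicits.

Lemma measurable_cube n k : measurable (cube n k).
Proof.
have -> : cube n k = \bigcap_i ((@tnth n _ ^~ i) @^-1` `[-k, k]).
  apply/seteqP; split=> t /= h i => [_|]; first by rewrite /= in_itv/= -ler_norml.
  by rewrite ler_norml; have := h i Logic.I; rewrite /= in_itv.
apply: fin_bigcap_measurable => // i _.
by rewrite -[X in measurable X]setTI; exact: measurable_tnth.
Qed.

Lemma cube_cons n k :
  @cons_pair R n @^-1` cube n.+1 k = `[-k, k]%classic `*` cube n k.
Proof.
apply/seteqP; split=> -[s t] /=.
  move=> h; split=> /=; first by rewrite in_itv/= -ler_norml; exact: (h ord0).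
  by move=> i; have := h (lift ord0 i); rewrite /= /cons_pair /= tnthS.
rewrite /= in_itv/= -ler_norml => -[hs ht] i.
by case: (unliftP ord0 i) => [j ->|->//]; rewrite /cons_pair /= tnthS; exact: ht.
Qed.

Lemma leb_cube n k : (leb n (cube n k) < +oo)%E.
Proof.
elim: n => [|n IHn] /=.
  by rewrite diracE; case: (_ \in _); rewrite ltry.
rewrite /leb_step /pushforward cube_cons product_measure2E//; last exact: measurable_cube.
apply: lte_mul_pinfty => //.
rewrite [X in X \is a _](lebesgue_measure_itv `[- k, k])/=.
by case: ifP => //; rewrite -EFinD.
Qed.

(* [leb n] with the sigma-finite structure that Fubini's theorem requires. *)
Definition sigma_finite_leb n : set (T n) -> \bar R := leb n.
Arguments sigma_finite_leb n : clear implicits.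
HB.instance Definition _ n := Measure.on (sigma_finite_leb n).

Let leb_sigma_finite n : sigma_finite setT (sigma_finite_leb n).
Proof.
exists (fun k => cube n k%:R).
  apply/seteqP; split=> // t _.
  exists (Num.truncn (\sum_i `|tnth t i|)).+1 => //= i.
  apply: le_trans (ltW (truncnS_gt _)).
  by rewrite (bigD1 i)//= lerDl sumr_ge0.
by move=> k; split; [exact: measurable_cube|exact: leb_cube].
Qed.
HB.instance Definition _ n := Measure_isSigmaFinite.Build _ _ _ (sigma_finite_leb n)
    (@leb_sigma_finite n).

Definition set_coord n (t : T n) (i : 'I_n) (s : R) : T n :=
  [tuple (if j == i then s else tnth t j) | j < n].

Lemma set_coord_cons0 n s0 (t : T n) s : set_coord (cons_pair (s0, t)) ord0 s = cons_pair (s, t).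
Proof.
apply: eq_from_tnth => j; rewrite tnth_mktuple.
by case: (unliftP ord0 j) => [i ->|->]; rewrite /= /cons_pair ?tnthS ?tnth0.
Qed.

Lemma set_coord_consS n s0 (t : T n) i s :
  set_coord (cons_pair (s0, t)) (lift ord0 i) s = cons_pair (s0, set_coord t i s).
Proof.
apply: eq_from_tnth => j; rewrite tnth_mktuple.
case: (unliftP ord0 j) => [k ->|->]; rewrite /= /cons_pair ?tnthS ?tnth0//.
by rewrite tnth_mktuple (inj_eq (@lift_inj _ _)).
Qed.

Local Open Scope ereal_scope.

(** Fubini with coordinate [i] innermost: if [i] is the head, integrate over the head first;
    otherwise integrate over the tail first, where the induction hypothesis applies. The bound and
    the bounded support provide integrability. *)
Lemma leb_integral_coord n (i : 'I_n) (f : T n -> R) (k b : R) :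
  measurable_fun setT f -> (forall t, `|f t| <= b)%R ->
  (forall t, ~ cube n k t -> f t = 0%R) ->
  (forall t, \int[lebesgue_measure]_s (f (set_coord t i s))%:E = 0) ->
  \int[leb n]_t (f t)%:E = 0.
Proof.
elim: n i f => [[]//|n IHn] i f mf fb f0 fi.
pose g (p : measurableTypeR R * T n) := f (cons_pair p).
have mg : measurable_fun setT g.
  by apply: measurableT_comp => //; exact: measurable_cons_pair.
have g0 p : ~ (`[(- k)%R, k]%classic `*` cube n k) p -> g p = 0%R.
  by rewrite -cube_cons => /f0.
have mK : measurable (`[(- k)%R, k]%classic `*` cube n k : set (measurableTypeR R * T n)).
  by apply: measurableX => //; exact: measurable_cube.
have Ioo : (lebesgue_measure (`[(- k)%R, k]%classic : set (measurableTypeR R)) < +oo)%E.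
  rewrite [ltLHS](lebesgue_measure_itv `[(- k)%R, k])/=.
  by case: ifP => //; rewrite -EFinD ltry.
have ig1 : (@lebesgue_measure R \x sigma_finite_leb n).-integrable setT (EFin \o g).
  apply: (integrable_bounded_support mK) mg _ g0 => [|p]; last exact: fb.
  rewrite [ltLHS]product_measure1E//; last exact: measurable_cube.
  by apply: lte_mul_pinfty => //; [rewrite ge0_fin_numE|exact: leb_cube].
have ig2 : (@lebesgue_measure R \x^ leb n).-integrable setT (EFin \o g).
  apply: (integrable_bounded_support mK) mg _ g0 => [|p]; last exact: fb.
  rewrite [ltLHS]product_measure2E//; last exact: measurable_cube.
  by apply: lte_mul_pinfty => //; [rewrite ge0_fin_numE|exact: leb_cube].
transitivity (\int[@lebesgue_measure R \x^ sigma_finite_leb n]_p (g p)%:E).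
  rewrite [LHS](@integral_pushforward _ _ _ _ R (@cons_pair R n) _
    (@lebesgue_measure R \x^ leb n)%E setT (EFin \o f))//.
  - exact: measurable_cons_pair.
  - exact/measurable_EFinP.
case: (unliftP ord0 i) fi => [j ->|->] fi.
  rewrite -integral12_prod_meas2//=; apply: integral0_eq => s _.
  apply: (IHn j) => [|t|t ht|t].
  - by apply: measurableT_comp => //; exact: measurable_cons.
  - exact: fb.
  - by apply: g0 => -[].
  - by rewrite -[RHS](fi (cons_pair (s, t))); apply: eq_integral => r _; rewrite set_coord_consS.
rewrite -integral21_prod_meas2//=; apply: integral0_eq => t _.
rewrite -[RHS](fi (cons_pair (0%R, t))).
by apply: eq_integral => r _; rewrite set_coord_cons0.
Qed.

End lebesgue_tuple.
Arguments cube {R} n k.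
Arguments sigma_finite_leb {R} n.

(** * Functions on the closed unit ball *)

Section continuous_at_big.
Context {R : realType} {V : topologicalType} {I : Type}.
Variables (r : seq I) (P : pred I) (f : I -> V -> R) (u : V).
Hypothesis cf : forall i, P i -> {for u, continuous (f i)}.

Lemma continuous_at_sum : {for u, continuous (fun v => \sum_(i <- r | P i) f i v)}.
Proof.
rewrite /prop_for /continuous_at.
elim: r => [|i s IHs].
  by rewrite big_nil; under eq_fun do rewrite big_nil; exact: cvg_cst.
rewrite big_cons; under eq_fun do rewrite big_cons; case: ifPn => // Pi.
by apply: cvgD => //; exact: cf.
Qed.

End continuous_at_big.

Section dot.
Context {R : realType} {m : nat}.
Implicit Types u v w : 'rV[R]_m.

Lemma dotE u v : dot u v = \sum_i u 0 i * v 0 i.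
Proof. by rewrite /dot mxE; apply: eq_bigr => i _; rewrite mxE. Qed.

Lemma dotC u v : dot u v = dot v u.
Proof. by rewrite !dotE; apply: eq_bigr => i _; rewrite mulrC. Qed.

Lemma dotDl u v w : dot (u + v) w = dot u w + dot v w.
Proof. by rewrite /dot mulmxDl mxE. Qed.

Lemma dotZl a u w : dot (a *: u) w = a * dot u w.
Proof. by rewrite /dot -scalemxAl mxE. Qed.

Lemma dotNl u w : dot (- u) w = - dot u w.
Proof. by rewrite /dot mulNmx mxE. Qed.

Lemma dotDr u v w : dot w (u + v) = dot w u + dot w v.
Proof. by rewrite dotC dotDl !(dotC w). Qed.

Lemma dotZr a u w : dot w (a *: u) = a * dot w u.
Proof. by rewrite dotC dotZl (dotC w). Qed.

Lemma dotNr u w : dot w (- u) = - dot w u.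
Proof. by rewrite dotC dotNl (dotC w). Qed.

Lemma dot_ge0 u : 0 <= dot u u.
Proof. by rewrite dotE sumr_ge0// => i _; rewrite -expr2 sqr_ge0. Qed.

Lemma dot_eq0 u : dot u u = 0 -> u = 0.
Proof.
rewrite dotE => /eqP; rewrite psumr_eq0; last by move=> i _; rewrite -expr2 sqr_ge0.
by move/allP => h; apply/rowP => i; have := h i (mem_index_enum _); rewrite mulf_eq0 orbb mxE =>
    /eqP.
Qed.

Lemma enorm_sqr u : enorm u ^+ 2 = dot u u.
Proof. by rewrite sqr_sqrtr// dot_ge0. Qed.

Lemma enorm_le1 u : (enorm u <= 1) = (dot u u <= 1).
Proof. by rewrite /enorm -[X in _ <= X]sqrtr1 ler_sqrt. Qed.

Lemma enorm_eq1 u : enorm u = 1 -> dot u u = 1.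
Proof. by rewrite -enorm_sqr => ->; rewrite expr1n. Qed.

Lemma dot_eq1 u : dot u u = 1 -> enorm u = 1.
Proof. by rewrite /enorm => ->; rewrite sqrtr1. Qed.

Lemma coord_le1 u i : dot u u <= 1 -> `|u 0 i| <= 1.
Proof.
move=> u1; rewrite -(@expr_le1 _ 2)// real_normK ?num_real//.
apply: le_trans u1; rewrite dotE (bigD1 i)//= -expr2 lerDl.
by apply: sumr_ge0 => j _; rewrite -expr2 sqr_ge0.
Qed.

Lemma continuous_dot_self : continuous (fun u => dot u u).
Proof.
move=> u; rewrite (_ : (fun u => dot u u) = fun u => \sum_i u 0 i * u 0 i); last first.
  by apply/funext => v; rewrite dotE.
apply: continuous_at_sum => i _.
apply: (@continuousM _ _ (fun v : 'rV[R]_m => v 0 i) (fun v => v 0 i)); exact: coord_continuous.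
Qed.

Lemma mx_norm_le u (e : R) : 0 <= e -> (forall i, `|u 0 i| <= e) -> `|u| <= e.
Proof.
move=> e0 ue; rewrite [leLHS]/Num.Def.normr/= mx_normrE.
by apply: bigmax_le => // -[i j] _ /=; rewrite ord1.
Qed.

End dot.

Section unit_ball.
Context {R : realType} {n : nat}.
Local Notation C := (closed_unit_ball R n).
Local Notation T := (n.-tuple (measurableTypeR R)).

Lemma compact_closed_unit_ball : compact C.
Proof.
apply: bounded_closed_compact.
  exists 1; split; first exact: num_real.
  move=> M M1 u; rewrite /closed_unit_ball /= enorm_le1 => u1.
  by apply: mx_norm_le => [|i]; [lra|rewrite (le_trans (coord_le1 _ u1))// ltW].
rewrite (_ : C = (fun u => dot u u) @^-1` [set x | x <= 1]).
  apply: closed_comp; last exact: closed_le.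
  by move=> u _; exact: continuous_dot_self.
by apply/seteqP; split=> u; rewrite /closed_unit_ball /= enorm_le1.
Qed.

Lemma closed_unit_ball0 : C 0.
Proof. by rewrite /closed_unit_ball/= enorm_le1 /dot mul0mx mxE. Qed.

Lemma continuous_bounded_ball (f : 'rV[R]_n -> R) :
  (forall u, C u -> {for u, continuous f}) ->
  exists2 b, 0 <= b & forall u, C u -> `|f u| <= b.
Proof.
move=> cf; have cf' : {within C, continuous (fun u => `|f u|)}.
  apply: continuous_in_subspaceT => u /[!inE] Cu.
  by apply: (continuous_comp (cf u Cu)); exact: norm_continuous.
have [c _ hc] := EVT_max_rV (ex_intro _ _ closed_unit_ball0) compact_closed_unit_ball cf'.
by exists `|f c| => // u Cu; apply: hc; rewrite inE.
Qed.

Definition row_of (t : T) : 'rV[R]_n := \row_i tnth t i.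

Definition ball_tuples : set T := [set t | C (row_of t)].

Lemma measurable_ball_tuples : measurable ball_tuples.
Proof.
rewrite (_ : ball_tuples = setT `&` (fun t : T => \sum_i tnth t i * tnth t i) @^-1` `]-oo,
    1]%classic).
  suff mf : measurable_fun setT (fun t : T => \sum_i tnth t i * tnth t i) by exact: mf.
  by apply: measurable_sum => i; apply: measurable_funM; exact: measurable_tnth.
apply/seteqP; split=> t; rewrite /ball_tuples /closed_unit_ball /= enorm_le1 dotE.
  move=> h; split => //; rewrite in_itv/=; apply: le_trans h.
  by apply/ler_sum => i _; rewrite mxE.
move=> [_]; rewrite in_itv/=; apply: le_trans.
by apply/ler_sum => i _; rewrite mxE.
Qed.

Lemma ball_tuples_cube : ball_tuples `<=` cube n 1.
Proof.
move=> t; rewrite /ball_tuples /closed_unit_ball /= enorm_le1 => h i.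
by have := coord_le1 i h; rewrite mxE.
Qed.

Lemma leb_ball_tuples : (leb n ball_tuples < +oo)%E.
Proof.
apply: le_lt_trans (@leb_cube R n 1); apply: le_measure; rewrite ?inE.
- exact: measurable_ball_tuples.
- exact: measurable_cube.
- exact: ball_tuples_cube.
Qed.

(* A continuous function is the limit of its values at lattice points, which
   are measurable because the lattice is countable. *)
Definition lattice_floor (N : nat) (t : T) : 'rV[R]_n :=
  \row_i ((Num.floor (N.+1%:R * tnth t i))%:~R / N.+1%:R).

Lemma measurable_lattice_floor N (f : 'rV[R]_n -> R) :
  measurable_fun setT (f \o lattice_floor N).
Proof.
move=> _ Y mY; rewrite setTI.
pose pt (z : {ffun 'I_n -> int}) : 'rV[R]_n := \row_i ((z i)%:~R / N.+1%:R).
pose cell (z : {ffun 'I_n -> int}) : set T :=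
  \bigcap_(i in [set: 'I_n]) [set t | Num.floor (N.+1%:R * tnth t i) = z i].
have -> : (f \o lattice_floor N) @^-1` Y =
    \bigcup_z (if f (pt z) \in Y then cell z else set0).
  apply/seteqP; split=> t /=.
    move=> Yt; exists [ffun i => Num.floor (N.+1%:R * tnth t i)] => //.
    rewrite (_ : pt _ = lattice_floor N t); last first.
      by apply/rowP => i; rewrite !mxE ffunE.
    by rewrite mem_set// => i _ /=; rewrite ffunE.
  move=> [z _]; case: ifPn => // /[!inE] Yz tz.
  rewrite (_ : lattice_floor N t = pt z)//.
  by apply/rowP => i; rewrite !mxE; congr (_%:~R / _); exact: (tz i).
apply: countable_bigcupT_measurable => [|z]; first exact: countableP.
case: ifP => // _; apply: fin_bigcap_measurable => // i _.
rewrite (_ : mkset _ = setT `&` (fun t : T => N.+1%:R * tnth t i) @^-1`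
    `[(z i)%:~R, (z i + 1)%:~R[%classic); last first.
  apply/seteqP; split=> t /=; rewrite in_itv/=.
    by move=> <-; split => //; exact: floor_itv.
  by move=> [_ h]; exact: floor_def.
have mf : measurable_fun setT (fun t : T => N.+1%:R * tnth t i).
  by apply: measurable_funM => //; exact: measurable_tnth.
by apply: mf => //; exact: measurable_itv.
Qed.

Lemma cvg_lattice_floor t : (lattice_floor ^~ t : nat -> 'rV[R]_n) @ \oo --> row_of t.
Proof.
apply/cvgrPdist_le => e e0; near=> N.
apply: mx_norm_le => [|i]; first exact: ltW.
have N0 : 0 < N.+1%:R :> R by [].
rewrite !mxE -[X in X - _](mulKf (lt0r_neq0 N0)) mulrC -mulrBl normrM.
rewrite (ger0_norm (x := _^-1)) ?invr_ge0// ler_pdivrMr//.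
rewrite (@le_trans _ _ 1)//.
  have /andP[h1 h2] := floor_itv (N.+1%:R * tnth t i).
  by rewrite intrD1 in h2; rewrite ger0_norm; lra.
rewrite mulrC -ler_pdivrMr// mul1r; near: N; exists (Num.truncn e^-1) => // N /= h.
apply: (le_trans (ltW (truncnS_gt _))).
by rewrite ler_nat ltnS.
Unshelve. all: by end_near. Qed.

(** Lattice points close to a point of the ball may lie outside it. Their values still converge,
    because continuity at the points of the ball is meant in the whole space. *)
Lemma measurable_continuous_ball (f : 'rV[R]_n -> R) :
  (forall u, C u -> {for u, continuous f}) ->
  measurable_fun ball_tuples (f \o row_of).
Proof.
move=> cf; apply: (@measurable_fun_cvg _ _ _ _ (fun N => f \o lattice_floor N)) => [N|t Ct].
  by apply: measurable_funTS; exact: measurable_lattice_floor.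
by apply: (cvg_comp _ _ (@cvg_lattice_floor t)); exact: cf.
Qed.

Lemma integrable_continuous_ball (f : 'rV[R]_n -> R) :
  (forall u, C u -> {for u, continuous f}) ->
  (leb n).-integrable ball_tuples (EFin \o (f \o row_of)).
Proof.
move=> cf; apply: measurable_bounded_integrable.
- exact: measurable_ball_tuples.
- exact: leb_ball_tuples.
- exact: measurable_continuous_ball.
have [b b0 fb] := continuous_bounded_ball cf.
exists b; split; first exact: num_real.
by move=> c bc t Ct /=; apply: le_trans (fb _ Ct) (ltW bc).
Qed.

End unit_ball.

(** * Continuously differentiable functions *)

Section C1.
Context {R : realType} {n : nat}.
Implicit Types (U : set 'rV[R]_n) (f g : 'rV[R]_n -> R).

Definition C1_on U f : Prop := forall u, U u ->
  differentiable f u /\ forall v, {for u, continuous ('D_v f)}.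

Lemma C1_continuous U f u : C1_on U f -> U u -> {for u, continuous f}.
Proof. by move=> cf Uu; apply: differentiable_continuous; exact: (cf _ Uu).1. Qed.

Lemma C1_derivable U f u v : C1_on U f -> U u -> derivable f u v.
Proof. by move=> cf Uu; apply: diff_derivable; exact: (cf _ Uu).1. Qed.

Lemma C1_cst U (a : R) : C1_on U (cst a).
Proof.
move=> u Uu; split => [|v]; first exact: differentiable_cst.
rewrite (_ : 'D_v (cst a) = cst 0); first exact: cst_continuous.
by apply/funext => w; rewrite derive_cst.
Qed.

Lemma derive_coord (i : 'I_n) u v : 'D_v (fun w : 'rV[R]_n => w 0 i) u = v 0 i.
Proof.
have /derive_mx : derivable (id : 'rV[R]_n -> 'rV[R]_n) u v by exact: derivable_id.
by rewrite derive_id => /rowP/(_ i) ->; rewrite mxE.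
Qed.

Lemma C1_coord U (i : 'I_n) : C1_on U (fun w : 'rV[R]_n => w 0 i).
Proof.
move=> u Uu; split => [|v]; first exact: differentiable_coord.
rewrite (_ : 'D_v _ = cst (v 0 i)); first exact: cst_continuous.
by apply/funext => w; rewrite derive_coord.
Qed.

Lemma C1_near U f (d : 'rV[R]_n -> 'rV[R]_n -> R) : open U ->
  (forall u, U u -> differentiable f u) ->
  (forall u v, U u -> 'D_v f u = d v u) ->
  (forall u v, U u -> {for u, continuous (d v)}) ->
  C1_on U f.
Proof.
move=> oU df fd cd u Uu; split => [|v]; first exact: df.
rewrite /prop_for /continuous_at fd//.
apply: cvg_trans (cd _ v Uu); apply: (@near_eq_cvg _ _ (nbhs u)).
by have := open_nbhs_nbhs (conj oU Uu); apply: filterS => w Uw; rewrite fd.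
Qed.

Lemma C1_D U f g : open U -> C1_on U f -> C1_on U g -> C1_on U (fun u => f u + g u).
Proof.
move=> oU cf cg; apply: (@C1_near _ _ (fun v u => 'D_v f u + 'D_v g u)) => // [u Uu|u v Uu|u v Uu].
- by apply: differentiableD; [case: (cf u Uu)|case: (cg u Uu)].
- by rewrite -deriveD//; exact: C1_derivable Uu.
- by apply: continuousD; [case: (cf u Uu)|case: (cg u Uu)].
Qed.

Lemma C1_M U f g : open U -> C1_on U f -> C1_on U g -> C1_on U (fun u => f u * g u).
Proof.
move=> oU cf cg; apply: (@C1_near _ _ (fun v u => f u * 'D_v g u + g u * 'D_v f u)) => // [u
    Uu|u v Uu|u v Uu].
- by apply: differentiableM; [case: (cf u Uu)|case: (cg u Uu)].
- rewrite -[LHS]/('D_v (f * g) u) deriveM//; exact: C1_derivable Uu.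
- have fu := C1_continuous cf Uu; have gu := C1_continuous cg Uu.
  apply: (@continuousD _ _ _ (fun u => f u * 'D_v g u) (fun u => g u * 'D_v f u)).
    by apply: continuousM => //; case: (cg u Uu).
  by apply: continuousM => //; case: (cf u Uu).
Qed.

Lemma C1_N U f : open U -> C1_on U f -> C1_on U (fun u => - f u).
Proof.
move=> oU cf; rewrite (_ : (fun u => _) = fun u => cst (-1) u * f u).
  by apply: C1_M => //; exact: C1_cst.
by apply/funext => u; rewrite mulN1r.
Qed.

Lemma C1_sum U I (r : seq I) (P : pred I) (F : I -> 'rV[R]_n -> R) : open U ->
  (forall i, P i -> C1_on U (F i)) -> C1_on U (fun u => \sum_(i <- r | P i) F i u).
Proof.
move=> oU cF; elim: r => [|i r IHr].
  have -> : (fun u => \sum_(i <- [::] | P i) F i u) = cst 0.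
    by apply/funext => u; rewrite big_nil.
  exact: C1_cst.
have -> : (fun u => \sum_(i <- i :: r | P i) F i u) = (fun u => (if P i then F i u else 0) +
    \sum_(j <- r | P j) F j u).
  by apply/funext => u; rewrite big_cons; case: ifP => //; rewrite add0r.
by apply: C1_D => //; case: (P i) (cF i) => [/(_ isT)//|_]; exact: C1_cst.
Qed.

Lemma C1_prod U I (r : seq I) (P : pred I) (F : I -> 'rV[R]_n -> R) : open U ->
  (forall i, P i -> C1_on U (F i)) -> C1_on U (fun u => \prod_(i <- r | P i) F i u).
Proof.
move=> oU cF; elim: r => [|i r IHr].
  have -> : (fun u => \prod_(i <- [::] | P i) F i u) = cst 1.
    by apply/funext => u; rewrite big_nil.
  exact: C1_cst.
have -> : (fun u => \prod_(i <- i :: r | P i) F i u) = (fun u => (if P i then F i u else 1) *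
    \prod_(i <- r | P i) F i u).
  by apply/funext => u; rewrite big_cons; case: ifP => //; rewrite mul1r.
by apply: C1_M => //; case: (P i) (cF i) => [/(_ isT)//|_]; exact: C1_cst.
Qed.

Lemma C1_det U m (F : 'rV[R]_n -> 'M[R]_m) : open U ->
  (forall i j, C1_on U (fun u => F u i j)) -> C1_on U (fun u => \det (F u)).
Proof.
move=> oU cF; rewrite /determinant; apply: C1_sum => // s _.
apply: C1_M => //; first exact: C1_cst.
by apply: C1_prod => // i _; exact: cF.
Qed.

Lemma is_derive_line f (a v : 'rV[R]_n) s : derivable f (a + s *: v) v ->
  is_derive s 1 (fun r : R => f (a + r *: v)) ('D_v f (a + s *: v)).
Proof.
have E : (fun h : R => h^-1 *: (((fun r : R => f (a + r *: v)) \o shift s) (h *: 1) - f (a + s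
    *: v)))
  = (fun h : R => h^-1 *: ((f \o shift (a + s *: v)) (h *: v) - f (a + s *: v))).
  apply/funext => h /=; congr (_ *: (f _ - _)).
  by rewrite [h *: 1]mulr1 scalerDl addrCA addrC.
by move=> df; split; rewrite /derivable /derive E.
Qed.

Lemma derive_sum_coord f u v : differentiable f u ->
  'D_v f u = \sum_i v 0 i * 'D_(delta_mx 0 i) f u.
Proof.
move=> df; rewrite deriveE// [v in LHS]row_sum_delta linear_sum.
by apply: eq_bigr => i _; rewrite linearZ /= deriveE.
Qed.

End C1.

(** * The divergence theorem for fields with zero flux *)

Section divergence.
Context {R : realType} {n : nat}.
Local Notation C := (closed_unit_ball R n).
Local Notation T := (n.-tuple (measurableTypeR R)).
Implicit Types (G : 'rV[R]_n -> R) (i : 'I_n).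

Lemma row_of_set_coord (t : T) i s :
  row_of (set_coord t i s) = row_of (set_coord t i 0) + s *: delta_mx 0 i.
Proof.
apply/rowP => j; rewrite !mxE !tnth_mktuple eqxx /= .
by case: eqP => _; rewrite ?add0r ?mulr1 ?mulr0 ?addr0.
Qed.

Lemma dot_line (t : T) i s :
  let u := row_of (set_coord t i s) in let u0 := row_of (set_coord t i 0) in
  dot u u = dot u0 u0 + s ^+ 2.
Proof.
move=> u u0; rewrite /u row_of_set_coord -/u0 !dotDl !dotDr !dotZl !dotZr.
have u0e : dot u0 (delta_mx 0 i) = 0.
  rewrite dotE big1// => j _; rewrite !mxE tnth_mktuple.
  by case: eqP => _; rewrite ?mul0r ?mulr0.
have -> : dot (delta_mx 0 i) (delta_mx 0 i) = 1 :> R.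
  rewrite dotE (bigD1 i)//= big1 ?mxE ?eqxx ?mulr1 ?addr0// => j ji.
  by rewrite !mxE (negPf ji) mulr0.
by rewrite (dotC _ u0) u0e !mulr0 addr0 add0r mulr1 expr2.
Qed.

Lemma integral_patch (h : R -> R) (A : set R) :
  (\int[lebesgue_measure]_s ((h \_ A) s)%:E =
   \int[lebesgue_measure]_(s in A) (h s)%:E)%E.
Proof.
rewrite [RHS]integral_mkcond; apply: eq_integral => s _.
by rewrite !patchE /=; case: ifP.
Qed.

(** The line meets the ball in the s with s^2 <= [rho], where [rho] is the square of half the length
    of the chord. The fundamental theorem of calculus gives the difference of [G] at the two ends,
    both on the sphere. *)
Lemma integral_chord G i t : 
  (forall u, C u -> derivable G u (delta_mx 0 i)) ->
  (forall u, C u -> {for u, continuous ('D_(delta_mx 0 i) G)}) ->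
  (forall u, C u -> {for u, continuous G}) ->
  (forall u, dot u u = 1 -> G u = 0) ->
  (\int[lebesgue_measure]_s
    (((('D_(delta_mx 0 i) G) \o row_of) \_ (@ball_tuples R n)) (set_coord t i s))%:E = 0)%E.
Proof.
move=> dG cdG cG G0; pose e : 'rV[R]_n := delta_mx 0 i.
pose u0 := row_of (set_coord t i 0); pose rho := 1 - dot u0 u0.
pose g s := 'D_e G (u0 + s *: e).
pose A : set R := [set s | s ^+ 2 <= rho].
have CE s : C (u0 + s *: e) <-> s ^+ 2 <= rho.
  rewrite -row_of_set_coord /closed_unit_ball/= enorm_le1 dot_line -/u0 /rho.
  by split; lra.
transitivity (\int[lebesgue_measure]_s ((g \_ A) s)%:E)%E.
  apply: eq_integral => s _; congr (_%:E); rewrite !patchE /= row_of_set_coord -/u0 -/e.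
  have -> // : (set_coord t i s \in @ball_tuples R n) = (s \in A).
  apply/idP/idP; rewrite !inE /ball_tuples /A/= row_of_set_coord -/u0 -/e => h.
    exact/CE.
  exact/CE.
(* Here the chord is empty or a single point, hence a null set. *)
have [rho0|rho0] := lerP rho 0.
  rewrite integral_patch; apply: (@integral_Sset1 _ _ _ 0) => s.
  rewrite /A /= => /le_trans/(_ rho0) s0.
  by apply/eqP; rewrite -sqrf_eq0 eq_le s0 sqr_ge0.
pose a := Num.sqrt rho.
have a0 : 0 < a by rewrite sqrtr_gt0.
have a2 : a ^+ 2 = rho by rewrite sqr_sqrtr// ltW.
have AE : A = `[- a, a]%classic.
  apply/seteqP; split=> s; rewrite /A /= in_itv/= -ler_norml -a2.
    by rewrite -[s ^+ 2]real_normK ?num_real// ler_sqr ?nnegrE// ltW.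
  by move=> h; rewrite -[s ^+ 2]real_normK ?num_real// ler_sqr ?nnegrE// ltW.
have inA s : s \in `[- a, a] -> C (u0 + s *: e).
  by move=> sa; apply/CE; have : A s by rewrite AE.
pose H s := G (u0 + s *: e).
have line_cont : continuous (fun s : R => u0 + s *: e).
  by move=> s; apply: cvgD; [exact: cvg_cst|exact: scalel_continuous].
have dH s : s \in `[- a, a] -> is_derive s 1 H (g s).
  by move=> /inA Cs; apply: is_derive_line; exact: dG.
have cH s : s \in `[- a, a] -> {for s, continuous H}.
  by move=> /inA Cs; apply: (@continuous_comp _ _ _ (fun s : R => u0 + s *: e) G); [exact:
      line_cont|exact: cG].
have end0 s : s ^+ 2 = rho -> H s = 0.
  move=> srho; apply: G0; rewrite -row_of_set_coord dot_line -/u0 srho /rho; lra.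
have oa : (- a < a) by lra.
rewrite AE integral_patch (@continuous_FTC2 _ g H)//.
- by rewrite !end0 ?sqrrN ?subee.
- apply: continuous_in_subspaceT => s /[!inE] /= sa.
  apply: (@continuous_comp _ _ _ (fun s : R => u0 + s *: e) ('D_e G)); first exact: line_cont.
  by apply: cdG; exact: inA.
- split=> [s|  |].
  + by move/subset_itv_oo_cc => /dH [].
  + by apply: cvg_at_right_filter; apply: cH; rewrite in_itv/= lexx ltW.
  + by apply: cvg_at_left_filter; apply: cH; rewrite in_itv/= lexx andbT ltW.
- by move=> s /subset_itv_oo_cc /dH [_]; rewrite derive1E.
Qed.

Lemma integral_partial_eq0 G i :
  (forall u, C u -> derivable G u (delta_mx 0 i)) ->
  (forall u, C u -> {for u, continuous ('D_(delta_mx 0 i) G)}) ->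
  (forall u, C u -> {for u, continuous G}) ->
  (forall u, dot u u = 1 -> G u = 0) ->
  (\int[leb n]_(t in @ball_tuples R n) ('D_(delta_mx 0 i) G (row_of t))%:E = 0)%E.
Proof.
move=> dG cdG cG G0.
have [b b0 fb] := continuous_bounded_ball cdG.
have mB := @measurable_ball_tuples R n.
rewrite integral_mkcond -[RHS](@leb_integral_coord R n i (('D_(delta_mx 0 i) G \o row_of) \_
    (@ball_tuples R n)) 1 b).
- by apply: eq_integral => t _; rewrite !patchE /=; case: ifP.
- by apply/(measurable_restrictT _ mB); exact: measurable_continuous_ball.
- by move=> t; rewrite patchE; case: ifPn => [/[!inE] Ct|_]; [exact: fb|rewrite normr0].
- move=> t ht; rewrite patchE memNset// => Ct; apply: ht; exact: ball_tuples_cube.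
- by move=> t; exact: integral_chord.
Qed.

Definition sphere_tuples : set T := [set t | dot (row_of t) (row_of t) = 1].

Lemma measurable_sphere_tuples : measurable sphere_tuples.
Proof.
have mf : measurable_fun setT (fun t : T => \sum_i tnth t i * tnth t i).
  by apply: measurable_sum => j; apply: measurable_funM; exact: measurable_tnth.
rewrite (_ : sphere_tuples = setT `&` (fun t : T => \sum_i tnth t i * tnth t i) @^-1` [set 1]).
  exact: mf.
apply/seteqP; split=> t; rewrite /sphere_tuples /= dotE.
  by move=> <-; split=> //; apply: eq_bigr => j _; rewrite mxE.
by move=> [_ <-]; apply: eq_bigr => j _; rewrite mxE.
Qed.

(** A line parallel to the [i]-th axis meets the sphere in at most two points, so the indicator
    integrates to 0 in that coordinate. *)
Lemma leb_sphere_eq0 i : leb n sphere_tuples = 0%E.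
Proof.
have mS := measurable_sphere_tuples.
transitivity (\int[leb n]_t (\1_sphere_tuples t)%:E)%E; first by rewrite integral_indic// setIT.
apply: (@leb_integral_coord R n i (\1_sphere_tuples) 1 1) => [|t|t ht|t].
- exact: measurable_indic.
- by rewrite indicE; case: (_ \in _); rewrite ?normr1 ?normr0.
- rewrite indicE memNset// => St; apply: ht; apply: ball_tuples_cube.
  by rewrite /ball_tuples /closed_unit_ball/= enorm_le1 St.
pose u0 := row_of (set_coord t i 0); pose a := Num.sqrt (1 - dot u0 u0).
pose A : set R := [set s | dot u0 u0 + s ^+ 2 = 1].
have finA : finite_set A.
  apply: (@sub_finite_set _ _ [set a; - a]); last exact: finite_set2.
  move=> s; rewrite /A /= => h.
  have /eqP : s ^+ 2 = a ^+ 2.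
    have -> : a = Num.sqrt (s ^+ 2) by rewrite /a -h; congr Num.sqrt; ring.
    by rewrite sqr_sqrtr// sqr_ge0.
  by rewrite eqf_sqr => /orP[]/eqP ->; [left|right].
transitivity (\int[lebesgue_measure]_s (\1_A s)%:E)%E.
  apply: eq_integral => s _; rewrite !indicE; congr (_%:R%:E); congr (nat_of_bool _).
  by apply/idP/idP; rewrite !inE /sphere_tuples /A /= dot_line.
have cA := finite_set_countable finA.
rewrite integral_indic ?setIT//; last exact: countable_measurable.
exact: countable_lebesgue_measure0.
Qed.

End divergence.

(** * Cutoff near the sphere and passage to the limit *)

Section zero_flux.
Context {R : realType} {n : nat}.
Local Notation C := (closed_unit_ball R n).
Local Notation T := (n.-tuple (measurableTypeR R)).
Variables (U : set 'rV[R]_n) (W : 'I_n -> 'rV[R]_n -> R).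
Hypotheses (oU : open U) (CU : C `<=` U) (W_C1 : forall i, C1_on U (W i)).
Hypothesis W0 : forall u : 'rV[R]_n, dot u u = 1 -> \sum_i u 0 i * W i u = 0.

Let w (u : 'rV[R]_n) := \sum_i u 0 i * W i u.

Lemma is_derive_dot_self (u v : 'rV[R]_n) :
  is_derive u v (fun u => dot u u) (2 * dot u v).
Proof.
have -> : (fun u : 'rV[R]_n => dot u u) = \sum_(i < n) ((fun u : 'rV[R]_n => u 0 i) * (fun u :
    'rV[R]_n => u 0 i)).
  by apply/funext => z; rewrite fct_sumE /= dotE.
have dc i : is_derive u v (fun z : 'rV[R]_n => z 0 i) (v 0 i).
  by rewrite -(derive_coord i u v); apply/derivableP/diff_derivable/differentiable_coord.
apply: is_derive_eq; rewrite dotE mulr_sumr; apply: eq_bigr => i _.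
by rewrite -!/(_ *: _) /GRing.scale/=; ring.
Qed.

Lemma C1_dot_self : C1_on U (fun u => dot u u).
Proof.
rewrite (_ : (fun u => _) = fun u : 'rV[R]_n => \sum_i u 0 i * u 0 i); last first.
  by apply/funext => z; rewrite dotE.
by apply: C1_sum => // i _; apply: C1_M => //; exact: C1_coord.
Qed.

Let C1_w : C1_on U w.
Proof. by apply: C1_sum => // i _; apply: C1_M => //; exact: C1_coord. Qed.

(* The flux density vanishes on the sphere, hence to first order near it. *)
Lemma flux_density_bound :
  exists2 K, 0 <= K & forall u, C u -> `|w u| <= K * (1 - dot u u).
Proof.
have /choice[b hb] : forall i, exists b, 0 <= b /\ forall u, C u -> `|'D_(delta_mx 0 i) w u| <= b.
  move=> i; have [|b b0 hb] := @continuous_bounded_ball _ _ ('D_(delta_mx 0 i) w).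
    by move=> u Cu; case: (C1_w (CU Cu)).
  by exists b.
exists (\sum_i b i) => [|u Cu]; first by apply: sumr_ge0 => i _; case: (hb i).
have [->|u0] := eqVneq u 0.
  rewrite /w big1 ?normr0; last by move=> i _; rewrite mxE mul0r.
  rewrite /dot mul0mx mxE subr0 mulr1; apply: sumr_ge0 => i _; by case: (hb i).
have s0 : 0 < dot u u.
  by rewrite lt0r dot_ge0 andbT; apply: contra_neq u0 => /dot_eq0.
have s1 : dot u u <= 1 by rewrite -enorm_le1.
(* Mean value theorem on the ray from [u] to the point [u1] of the sphere, where [w] vanishes. The
   sum of the [b i] bounds the derivative along the unit vector [u1], and 1 - r <= 1 - r^2. *)
pose r := enorm u; have r2 : r ^+ 2 = dot u u by exact: enorm_sqr.
have r0 : 0 < r by rewrite sqrtr_gt0.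
have r1 : r <= 1 by [].
pose u1 := r^-1 *: u.
have u11 : dot u1 u1 = 1.
  by rewrite dotZl dotZr -r2; field; rewrite gt_eqF.
have uE : u = 0 + r *: u1 by rewrite add0r scalerA divff ?gt_eqF// scale1r.
have inC s : s \in `[r, 1] -> C (0 + s *: u1).
  rewrite in_itv/= => /andP[rs s1']; rewrite /closed_unit_ball/= enorm_le1 add0r dotZl dotZr u11.
  by rewrite mulr1 -expr2 expr_le1//; lra.
pose h s := w (0 + s *: u1).
pose h' (s : R) : R := 'D_u1 w (0 + s *: u1).
have dh s : s \in `[r, 1] -> is_derive s 1 h (h' s).
  move=> /inC Cs; apply: is_derive_line.
  exact: C1_derivable C1_w (CU Cs).
have dh_oo s : s \in `]r, 1[ -> is_derive s 1 h (h' s).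
  by move=> /subset_itv_oo_cc; exact: dh.
have ch : {within `[r, 1], continuous h}.
  apply: continuous_in_subspaceT => s /[!inE] /= /dh [dhs _].
  by apply: differentiable_continuous; exact/derivable1_diffP.
have [c cr hc] := @MVT_segment R h h' r 1 r1 dh_oo ch.
have h1 : h 1 = 0 by rewrite /h add0r scale1r; exact: W0.
have -> : w u = - (h' c * (1 - r)).
  by rewrite -hc h1 {1}uE sub0r opprK.
rewrite normrN normrM; apply: ler_pM => //.
  rewrite /h' derive_sum_coord; last exact: (C1_w (CU (inC _ cr))).1.
  apply: le_trans (ler_norm_sum _ _ _) _; apply: ler_sum => i _.
  rewrite normrM -[b i]mul1r; apply: ler_pM => //.
    by apply: coord_le1; rewrite u11.
  by case: (hb i) => _; apply; exact: inC.
rewrite ger0_norm; last by lra.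
by rewrite -r2; nra.
Qed.

(** Each of the m + 1 terms of the geometric sum is at least s^m. With [flux_density_bound], this
    bounds uniformly in m the term that comes from the gradient of the cutoff. *)
Lemma sum_pow_le1 (s : R) m : 0 <= s -> s <= 1 -> m.+1%:R * s ^+ m * (1 - s) <= 1.
Proof.
move=> s0 s1; have := subrX1 s m.+1.
have : m.+1%:R * s ^+ m <= \sum_(i < m.+1) s ^+ i.
  rewrite mulr_natl -[X in _ *+ X]card_ord -sumr_const; apply: ler_sum => i _.
  by apply: ler_wiXn2l => //; rewrite -ltnS.
have := exprn_ge0 m.+1 s0.
move: (\sum_i _) (m.+1%:R * _) (s ^+ m.+1) => A B D D0 BA DA; nra.
Qed.

(** With s = r^2, one factor r^m absorbs m + 1 through [sum_pow_le1], and the other tends to 0. *)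
Lemma cvg_natr_expr (s : R) : 0 <= s < 1 -> m.+1%:R * s ^+ m @[m --> \oo] --> 0.
Proof.
move=> /andP[s0 s1]; pose r := Num.sqrt s.
have r0 : 0 <= r by exact: sqrtr_ge0.
have r1 : r < 1 by rewrite /r -[X in _ < X]sqrtr1 ltr_sqrt.
have rs : s = r * r by rewrite -expr2 sqr_sqrtr.
apply: (@squeeze_cvgr _ _ _ _ (cst 0) (fun m => (1 - r)^-1 * r ^+ m)).
- near=> m; rewrite mulr_ge0 ?exprn_ge0//= rs exprMn mulrA.
  rewrite ler_wpM2r ?exprn_ge0// -[leRHS]mul1r ler_pdivlMr ?subr_gt0//.
  exact: sum_pow_le1 (ltW r1).
- exact: cvg_cst.
- rewrite -[X in _ --> X](mulr0 (1 - r)^-1); apply: cvgM; first exact: cvg_cst.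
  by apply: cvg_expr; rewrite ger0_norm.
Unshelve. all: by end_near. Qed.

Let div (u : 'rV[R]_n) := \sum_i 'D_(delta_mx 0 i) (W i) u.
(** The exponent is shifted by one so that the gradient of the cutoff, - 2 (m + 1) |u|^(2m) u,
    involves no predecessor. *)
Let G m i (u : 'rV[R]_n) := (1 - dot u u ^+ m.+1) * W i u.

Let C1_pow m : C1_on U (fun u : 'rV[R]_n => dot u u ^+ m).
Proof.
rewrite (_ : (fun u => _) = fun u : 'rV[R]_n => \prod_(j < m) dot u u); last first.
  by apply/funext => u; rewrite prodr_const card_ord.
by apply: (@C1_prod _ _ U _ _ xpredT (fun _ u => dot u u) oU) => j _; exact: C1_dot_self.
Qed.

Let C1_G m i : C1_on U (G m i).
Proof.
apply: (C1_M oU _ (W_C1 i)); apply: (C1_D oU (@C1_cst _ _ U 1)).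
exact: (C1_N oU (C1_pow m.+1)).
Qed.

Let div_G m u : C u -> \sum_i 'D_(delta_mx 0 i) (G m i) u =
  (1 - dot u u ^+ m.+1) * div u - 2 * (m.+1%:R * dot u u ^+ m * w u).
Proof.
move=> Cu; rewrite /div /w !mulr_sumr -sumrB; apply: eq_bigr => i _.
pose sq := fun u : 'rV[R]_n => dot u u.
have dsq : is_derive u (delta_mx 0 i) sq (2 * u 0 i).
  have := is_derive_dot_self u (delta_mx 0 i); rewrite dotE (bigD1 i)//= big1.
    by rewrite addr0 mxE !eqxx mulr1.
  by move=> j ji; rewrite mxE eqxx /= (negPf ji) mulr0.
have dW : is_derive u (delta_mx 0 i) (W i) ('D_(delta_mx 0 i) (W i) u).
  by apply: derivableP; exact: C1_derivable (W_C1 i) (CU Cu).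
have : is_derive u (delta_mx 0 i) ((cst 1 - sq ^+ m.+1) * W i)
    ((1 - dot u u ^+ m.+1) * 'D_(delta_mx 0 i) (W i) u
      - 2 * (m.+1%:R * dot u u ^+ m * (u 0 i * W i u))).
  apply: is_derive_eq; rewrite /GRing.scale/= !fctE/= -/(sq u) /cst.
  ring.
have -> : G m i = (cst 1 - sq ^+ m.+1) * W i.
  by apply/funext => z; rewrite /G !fctE.
by move=> [_ ->].
Qed.

(** Dominated convergence: the divergence of each cutoff field integrates to 0. In the dominating
    constant, [b] bounds [div] and [2 * K] bounds the cutoff term. *)
Theorem divergence_zero_flux (i0 : 'I_n) :
  (\int[leb n]_(t in @ball_tuples R n) (div (row_of t))%:E = 0)%E.
Proof.
have mB := @measurable_ball_tuples R n.
have [K K0 hK] := flux_density_bound.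
have cdiv u : C u -> {for u, continuous div}.
  by move=> Cu; apply: continuous_at_sum => i _; case: (W_C1 i (CU Cu)).
have [b b0 hb] := continuous_bounded_ball cdiv.
pose F m u := \sum_i 'D_(delta_mx 0 i) (G m i) u.
have cDG m i u : C u -> {for u, continuous ('D_(delta_mx 0 i) (G m i))}.
  by move=> Cu; case: (C1_G m i (CU Cu)).
have cF m u : C u -> {for u, continuous (F m)}.
  by move=> Cu; apply: continuous_at_sum => i _; exact: cDG.
have F0 m : (\int[leb n]_(t in @ball_tuples R n) (F m (row_of t))%:E = 0)%E.
  under eq_integral do rewrite /F -sumEFin.
  rewrite (@integral_sum _ _ _ _ _ mB _
    (fun i t => ('D_(delta_mx 0 i) (G m i) (row_of t))%:E)); last first.
    move=> i; apply: (@integrable_continuous_ball R n ('D_(delta_mx 0 i) (G m i))) => u.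
    exact: cDG.
  apply: big1 => i _; apply: integral_partial_eq0.
  - by move=> u Cu; apply: C1_derivable (C1_G m i) (CU Cu).
  - by move=> u Cu; exact: cDG.
  - by move=> u Cu; apply: C1_continuous (C1_G m i) (CU Cu).
  - by move=> u u1; rewrite /G u1 expr1n subrr mul0r.
have := @dominated_convergence _ _ R (leb n) (@ball_tuples R n) mB
  (fun m t => (F m (row_of t))%:E) (fun t => (div (row_of t))%:E)
  (cst (b + 2 * K)%:E).
case.
- by move=> m; apply/measurable_EFinP; exact: (@measurable_continuous_ball R n (F m) (@cF m)).
- by apply/measurable_EFinP; exact: (@measurable_continuous_ball R n div cdiv).
(* On the sphere every [F m] is 0, so convergence to [div] can fail there and only there. *)
- exists (@sphere_tuples R n); split.
  + exact: measurable_sphere_tuples.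
  + exact: leb_sphere_eq0 i0.
  + move=> t /=; apply: contra_notP => t1 Ct.
    have Ct' := Ct; rewrite /ball_tuples/closed_unit_ball/= enorm_le1 in Ct'.
    have s01 : 0 <= dot (row_of t) (row_of t) < 1.
      by rewrite dot_ge0/= lt_neqAle Ct' andbT; exact/eqP.
    apply: cvg_EFin; first by apply: nearW.
    rewrite (_ : _ \o _ = fun m => (1 - dot (row_of t) (row_of t) ^+ m.+1) * div (row_of t)
      - 2 * (m.+1%:R * dot (row_of t) (row_of t) ^+ m * w (row_of t))); last first.
      by apply/funext => m; exact: div_G.
    rewrite -[X in _ --> X]subr0; apply: cvgB.
      rewrite -[X in _ --> X]mul1r; apply: cvgM; last exact: cvg_cst.
      rewrite -[X in _ --> X]subr0; apply: cvgB; first exact: cvg_cst.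
      rewrite (cvg_shiftS (fun m => dot (row_of t) (row_of t) ^+ m)); apply: cvg_expr.
      by rewrite ger0_norm; case/andP: s01.
    rewrite -[X in _ --> X](mulr0 2); apply: cvgM; first exact: cvg_cst.
    rewrite -[X in _ --> X](mul0r (w (row_of t))); apply: cvgM; last exact: cvg_cst.
    exact: cvg_natr_expr.
- apply: (@integrable_continuous_ball R n (cst (b + 2 * K))) => u _.
  exact: cst_continuous.
- apply: aeW => t m Ct; rewrite lee_fin [F m _](div_G m Ct).
  have s0 := dot_ge0 (row_of t).
  have s1 : dot (row_of t) (row_of t) <= 1 by rewrite -enorm_le1.
  apply: le_trans (ler_normB _ _) _; apply: lerD.
    rewrite normrM -[b]mul1r; apply: ler_pM => //; last exact: hb.
    by rewrite ger0_norm ?subr_ge0 ?exprn_ile1// gerBl exprn_ge0.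
  rewrite !normrM !(ger0_norm (x := 2))// ler_pM2l//.
  rewrite ger0_norm// ger0_norm ?exprn_ge0//.
  apply: le_trans (ler_wpM2l _ (hK _ Ct)) _; first by rewrite mulr_ge0// exprn_ge0.
  rewrite mulrCA -[leRHS]mulr1 ler_wpM2l//; exact: sum_pow_le1.
move=> _ _; rewrite (_ : [sequence _]_n = cst 0%E).
  by move=> /cvg_lim <-//; rewrite lim_cst.
by apply/funext => m /=; exact: F0.
Qed.

End zero_flux.

(** * Mixed derivatives and derivatives of determinants *)

Lemma dist_le_half (R : realFieldType) (p q c e : R) :
  `|p - c| <= e / 2 -> `|q - c| <= e / 2 -> `|p - q| <= e.
Proof. by rewrite !ler_norml => /andP[? ?] /andP[? ?]; apply/andP; split; lra. Qed.

Lemma sg_continuous_neq0 (R : realType) (f : R -> R) :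
  {within `[0, 1], continuous f} -> (forall s, s \in `[0, 1] -> f s != 0) ->
  Num.sg (f 1) = Num.sg (f 0).
Proof.
move=> cf fn0.
have no0 : ~ (Num.min (f 0) (f 1) <= 0 <= Num.max (f 0) (f 1)).
  by move=> /(IVT ler01 cf) [s s01 fs]; have := fn0 s s01; rewrite fs eqxx.
have n0 : f 0 != 0 by apply: fn0; rewrite in_itv/= lexx ler01.
have n1 : f 1 != 0 by apply: fn0; rewrite in_itv/= lexx ler01.
move: no0 n0 n1; move: (f 0) (f 1) => a b; rewrite ge_min le_max.
case: (ltgtP a 0) => // a0; case: (ltgtP b 0) => // b0 h _ _;
  rewrite ?(ltr0_sg a0) ?(gtr0_sg a0) ?(ltr0_sg b0) ?(gtr0_sg b0)//;
  by case: h; rewrite ?(ltW a0) ?(ltW b0) ?orbT.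
Qed.

(** * Symmetry of second derivatives *)

Section schwarz.
Context {R : realType} {n : nat}.
Implicit Types (f g fa fb : 'rV[R]_n -> R) (a b u : 'rV[R]_n).

(** The mean value theorem is applied twice: along [a] to the increment of [f] in direction
    [h *: b], then along [b] to the derivative [g] at the parameter [r] just found. *)
Lemma second_difference f g a b u (h : R) : 0 < h ->
  (forall r s, r \in `[0, h] -> s \in `[0, h] ->
    is_derive (u + s *: b + r *: a) a f (g (u + s *: b + r *: a)) /\
    derivable g (u + r *: a + s *: b) b) ->
  exists r s, [/\ r \in `[0, h], s \in `[0, h] &
    f (u + h *: b + h *: a) - f (u + h *: a) - (f (u + h *: b) - f u) =
      h ^+ 2 * 'D_b g (u + r *: a + s *: b)].
Proof.
move=> h0 df.
have h00 : 0 \in `[0, h] by rewrite in_itv/= lexx ltW.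
have h0h : h \in `[0, h] by rewrite in_itv/= lexx ltW.
pose phi (r : R) : R := f (u + h *: b + r *: a) - f (u + 0 *: b + r *: a).
pose phi' (r : R) : R := g (u + h *: b + r *: a) - g (u + 0 *: b + r *: a).
have dphi r : r \in `[0, h] -> is_derive r 1 phi (phi' r).
  move=> rh; have [[H1 E1] _] := df r h rh h0h; have [[H0 E0] _] := df r 0 rh h00.
  rewrite /phi' -E1 -E0.
  exact: (is_deriveB (is_derive_line H1) (is_derive_line H0)).
have dphi' r : r \in `]0, h[ -> is_derive r 1 phi (phi' r).
  by move=> /subset_itv_oo_cc; exact: dphi.
have cphi : {within `[0, h], continuous phi}.
  apply: continuous_in_subspaceT => s /[!inE] /= /dphi [dhs _].
  by apply: differentiable_continuous; exact/derivable1_diffP.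
have [r rh Er] := @MVT_segment R phi phi' 0 h (ltW h0) dphi' cphi.
pose psi (s : R) : R := g (u + r *: a + s *: b).
pose psi' (s : R) : R := 'D_b g (u + r *: a + s *: b).
have dpsi s : s \in `[0, h] -> is_derive s 1 psi (psi' s).
  by move=> sh; apply: is_derive_line; case: (df r s rh sh).
have dpsi' s : s \in `]0, h[ -> is_derive s 1 psi (psi' s).
  by move=> /subset_itv_oo_cc; exact: dpsi.
have cpsi : {within `[0, h], continuous psi}.
  apply: continuous_in_subspaceT => s /[!inE] /= /dpsi [dhs _].
  by apply: differentiable_continuous; exact/derivable1_diffP.
have [s sh Es] := @MVT_segment R psi psi' 0 h (ltW h0) dpsi' cpsi.
exists r, s; split => //.
have -> : f (u + h *: b + h *: a) - f (u + h *: a) - (f (u + h *: b) - f u) = phi h - phi 0.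
  by rewrite /phi !scale0r !addr0.
rewrite Er subr0 -/(psi' s).
have -> : phi' r = psi h - psi 0.
  by rewrite /phi' /psi; congr (g _ - g _); rewrite addrAC.
by rewrite Es subr0 -mulrA -expr2 mulrC.
Qed.

(** The second difference is symmetric in [a] and [b], so the two mixed derivatives agree at two
    points that may differ but are both close to [u]; continuity of both at [u] concludes. *)
Lemma derive_comm f fa fb a b (U : set 'rV[R]_n) u : open U -> U u ->
  (forall w, U w -> is_derive w a f (fa w)) ->
  (forall w, U w -> is_derive w b f (fb w)) ->
  C1_on U fa -> C1_on U fb -> 'D_b fa u = 'D_a fb u.
Proof.
move=> oU Uu fC fC' aC bC.
have key (e : R) : 0 < e -> `|'D_b fa u - 'D_a fb u| <= e.
  move=> e0.
  have e20 : 0 < e / 2 by lra.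
  pose B1 := [set t | `|'D_b fa u - 'D_b fa t| <= e / 2].
  pose B2 := [set t | `|'D_a fb u - 'D_a fb t| <= e / 2].
  have ba : nbhs u B1 by move/cvgrPdist_le: ((aC u Uu).2 b) => /(_ _ e20).
  have ab : nbhs u B2 by move/cvgrPdist_le: ((bC u Uu).2 a) => /(_ _ e20).
  have nU := open_nbhs_nbhs (conj oU Uu).
  have /nbhs_ballP[d /= d0] : nbhs u (U `&` (B1 `&` B2)).
    exact: (filterI nU (filterI ba ab)).
  rewrite -ball_normE => hd.
  (* Small enough for the parallelogram with sides [h *: a] and [h *: b] to stay within distance [d]
     of [u]; the summand 1 covers a = b = 0. *)
  pose h := d / (2 * (`|a| + `|b| + 1)).
  have c0 : 0 < 2 * (`|a| + `|b| + 1).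
    by rewrite mulr_gt0// ltr_wpDl ?addr_ge0.
  have h0 : 0 < h by rewrite divr_gt0.
  have near_u r s : r \in `[0, h] -> s \in `[0, h] -> `|u - (u + r *: a + s *: b)| < d.
    rewrite !in_itv/= => /andP[r0 rh] /andP[s0 sh].
    rewrite -addrA opprD addrA subrr add0r normrN.
    apply: le_lt_trans (ler_normD _ _) _; rewrite !normrZ (ger0_norm r0) (ger0_norm s0).
    apply: (@le_lt_trans _ _ (h * (`|a| + `|b|))).
      by rewrite mulrDr lerD// ler_wpM2r.
    rewrite /h mulrAC ltr_pdivrMr// ltr_pM2l//.
    by have := normr_ge0 a; have := normr_ge0 b; lra.
  have [|r1 [s1 [hr1 hs1 E1]]] := @second_difference f fa a b u h h0.
    move=> r s hr hs; rewrite (addrAC u).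
    have [Up _] := hd _ (near_u _ _ hr hs).
    by split; [exact: fC|exact: (C1_derivable (v := b) aC Up)].
  have [|r2 [s2 [hr2 hs2 E2]]] := @second_difference f fb b a u h h0.
    move=> r s hr hs; rewrite (addrAC u).
    have := near_u _ _ hs hr; rewrite addrAC => /hd [Up _].
    by split; [exact: fC'|exact: (C1_derivable (v := a) bC Up)].
  have [_ [/= b1 _]] := hd _ (near_u _ _ hr1 hs1).
  have := near_u _ _ hs2 hr2; rewrite addrAC => /hd [_ [/= _ b2]].
  have E : 'D_b fa (u + r1 *: a + s1 *: b) = 'D_a fb (u + r2 *: b + s2 *: a).
    apply: (mulfI (x := h ^+ 2)); first by rewrite expf_neq0// gt_eqF.
    apply: etrans (esym E1) _; apply: etrans _ E2.
    have -> : u + h *: a + h *: b = u + h *: b + h *: a by rewrite addrAC.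
    move: (f (u + h *: b + h *: a)) (f (u + h *: a)) (f (u + h *: b)) (f u) => p q r s.
    by ring.
  rewrite /B1 /= E in b1; rewrite /B2 /= in b2.
  exact: dist_le_half b1 b2.
move: key; move: ('D_b fa u) ('D_a fb u) => p q key.
apply/eqP; rewrite -subr_eq0 -normr_eq0 eq_le normr_ge0 andbT.
by apply/ler_addgt0Pr => e /key; rewrite add0r.
Qed.

End schwarz.

Section derive_det.
Context {R : realType} {V : normedModType R}.
Variables (u v : V).

Lemma is_derive_bigsum I (r : seq I) (F : I -> V -> R) (dF : I -> R) :
  (forall i, is_derive u v (F i) (dF i)) ->
  is_derive u v (fun w => \sum_(i <- r) F i w) (\sum_(i <- r) dF i).
Proof.
move=> dFi; elim: r => [|i r IHr].
  rewrite big_nil (_ : (fun w => _) = cst 0); first exact: is_derive_cst.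
  by apply/funext => w; rewrite big_nil.
rewrite big_cons (_ : (fun w => _) = F i + (fun w => \sum_(j <- r) F j w)).
  exact: is_deriveD.
by apply/funext => w; rewrite big_cons.
Qed.

Lemma is_derive_bigprod m (F : 'I_m -> V -> R) (dF : 'I_m -> R) :
  (forall i, is_derive u v (F i) (dF i)) ->
  is_derive u v (fun w => \prod_i F i w)
    (\sum_i \prod_j (if j == i then dF j else F j u)).
Proof.
elim: m F dF => [|m IHm] F dF dFi.
  rewrite big_ord0 (_ : (fun w => _) = cst 1); first exact: is_derive_cst.
  by apply/funext => w; rewrite big_ord0.
rewrite (_ : (fun w => _) = F ord0 * (fun w => \prod_i F (lift ord0 i) w)); last first.
  by apply/funext => w; rewrite big_ord_recl.
have := IHm (fun i => F (lift ord0 i)) (fun i => dF (lift ord0 i)) (fun i => dFi _).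
move=> H; apply: is_derive_eq; rewrite [RHS]big_ord_recl [LHS]addrC /GRing.scale/=; congr (_ + _).
  by rewrite [RHS]big_ord_recl eqxx [LHS]mulrC.
rewrite mulr_sumr; apply: eq_bigr => i _; rewrite big_ord_recl (negPf (neq_lift _ _)).
by congr (_ * _); apply: eq_bigr => j _; rewrite (inj_eq (@lift_inj _ _)).
Qed.

Lemma is_derive_det m (A : V -> 'M[R]_m) (dA : 'M[R]_m) :
  (forall i j, is_derive u v (fun w => A w i j) (dA i j)) ->
  is_derive u v (fun w => \det (A w)) (\sum_i \det (set_row (A u) i (row i dA))).
Proof.
move=> dAij.
have H (s : 'S_m) : is_derive u v (fun w => (-1) ^+ s * \prod_i A w i (s i))
    ((-1) ^+ s * \sum_i \prod_j (if j == i then dA j (s j) else A u j (s j))).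
  have H := @is_derive_bigprod m (fun i w => A w i (s i)) (fun i => dA i (s i)) (fun i => dAij _ _).
  exact: (@is_deriveZ _ _ _ (fun w => \prod_i A w i (s i)) ((-1) ^+ s)).
have := @is_derive_bigsum _ (index_enum _) _ _ H.
rewrite (_ : \sum_(s <- _) _ = \sum_i \det (set_row (A u) i (row i dA)))//.
under eq_bigr do rewrite mulr_sumr.
rewrite exchange_big; apply: eq_bigr => i _; apply: eq_bigr => s _; congr (_ * _).
by apply: eq_bigr => j _; rewrite !mxE; case: eqP => // ->.
Qed.

End derive_det.

(** * Differentiating identities known only on the ball or on the sphere *)

Section ball_identities.
Context {R : realType} {n : nat}.
Local Notation C := (closed_unit_ball R n).
Implicit Types (f : 'rV[R]_n -> R) (u v : 'rV[R]_n).

(** Approach [u] radially by interior points. An identity on the closed ball can be differentiated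
    directly only in the interior; this carries the result to the boundary. *)
Lemma ball_closure_eq0 f : (forall u, C u -> {for u, continuous f}) ->
  (forall u, dot u u < 1 -> f u = 0) -> forall u, C u -> f u = 0.
Proof.
move=> cf f0 u Cu.
have cu : ((1 - harmonic k) *: u : 'rV[R]_n) @[k --> \oo] --> u.
  rewrite -[X in _ --> X]scale1r -[X in X *: _]subr0.
  by apply: cvgZl; apply: cvgB; [exact: cvg_cst|exact: cvg_harmonic].
have : f ((1 - harmonic k) *: u) @[k --> \oo] --> f u.
  by apply: (cvg_comp _ _ cu); exact: cf.
rewrite (_ : (fun k => _) = cst 0).
  by move=> /cvg_lim <-//; rewrite lim_cst.
apply/funext => k; apply: f0; rewrite dotZl dotZr mulrA.
have k0 : 0 < harmonic k :> R by rewrite /harmonic invr_gt0.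
have k1 : harmonic k <= 1 :> R by rewrite /harmonic invf_le1// ler1n.
have u1 : dot u u <= 1 by rewrite -enorm_le1.
apply: (@le_lt_trans _ _ ((1 - harmonic k) * (1 - harmonic k))).
  by rewrite -[leRHS]mulr1 ler_wpM2l// mulr_ge0// subr_ge0.
by move: (harmonic k) k0 k1 => h k0 k1; nra.
Qed.

Lemma open_ball_derive_eq0 f v : (forall u, dot u u < 1 -> f u = 0) ->
  forall u, dot u u < 1 -> 'D_v f u = 0.
Proof.
move=> f0 u u1; rewrite -[RHS](derive_cst (0 : R) u v); apply: near_eq_derive.
have oB : open [set w : 'rV[R]_n | dot w w < 1].
  rewrite (_ : mkset _ = (fun w : 'rV[R]_n => dot w w) @^-1` [set x | x < 1])//.
  by apply: open_comp; [move=> w _; exact: continuous_dot_self|exact: open_lt].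
by have := open_nbhs_nbhs (conj oB u1); apply: filterS => w /f0.
Qed.

(** Compose with the great circle cos s u + sin s v1, where v1 is [v] normalised: it stays on the
    sphere and leaves [u] with velocity v1. *)
Lemma sphere_tangent_derive f u v (a : R) : differentiable f u ->
  dot u u = 1 -> dot u v = 0 -> (forall w, dot w w = 1 -> f w = a) ->
  'D_v f u = 0.
Proof.
move=> df u1 uv fa.
have [->|v0] := eqVneq v 0; first by rewrite derive0.
have r0 : 0 < enorm v.
  by rewrite sqrtr_gt0 lt0r dot_ge0 andbT; apply: contra_neq v0 => /dot_eq0.
pose v1 := (enorm v)^-1 *: v.
have v11 : dot v1 v1 = 1.
  by rewrite dotZl dotZr -enorm_sqr; field; rewrite gt_eqF.
have uv1 : dot u v1 = 0 by rewrite dotZr uv mulr0.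
have vE : v = enorm v *: v1 by rewrite scalerA divff ?gt_eqF// scale1r.
clearbody v1.
pose gam (s : R) : 'rV[R]_n := cos s *: u + sin s *: v1.
have gam0 : gam 0 = u by rewrite /gam cos0 sin0 scale1r scale0r addr0.
have dgam : differentiable gam 0.
  apply: differentiableD; apply: differentiableZl; apply/derivable1_diffP.
    exact: derivable_cos.
  exact: derivable_sin.
have Dgam : 'D_1 gam 0 = v1.
  rewrite derive_mx; last exact/derivable1_diffP.
  apply/rowP => j; rewrite !mxE.
  rewrite (_ : (fun s => gam s 0 j) = (fun s => u 0 j * cos s) + (fun s => v1 0 j * sin s));
      last first.
    by apply/funext => s; rewrite /gam !mxE !fctE; ring.
  have := @is_deriveD _ _ _ (fun s => u 0 j * cos s) (fun s => v1 0 j * sin s) 0 1 _ _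
    (is_deriveZ (u 0 j) (is_derive_cos 0)) (is_deriveZ (v1 0 j) (is_derive_sin 0)).
  move=> [_ ->]; by rewrite sin0 cos0 /GRing.scale/= oppr0 mulr0 add0r mulr1.
have dfg : differentiable (f \o gam) 0 by apply: differentiable_comp; rewrite ?gam0.
have : 'D_1 (f \o gam) 0 = 0.
  rewrite (_ : f \o gam = cst a) ?derive_cst//.
  apply/funext => s /=; apply: fa; rewrite /gam !dotDl !dotDr !dotZl !dotZr (dotC v1) uv1 u1 v11.
  by rewrite !mulr0 !mulr1 addr0 add0r -!expr2 cos2Dsin2.
rewrite deriveE// diff_comp ?gam0//= -[X in 'd f u X]deriveE// Dgam => E.
by rewrite vE deriveE// linearZ /= E scaler0.
Qed.

End ball_identities.

(** * The hypersurface *)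

Section smooth.
Context {R : realType} {n m : nat}.
Variables (U : set 'rV[R]_n) (oU : open U).
Implicit Types (f g : 'rV[R]_n -> 'rV[R]_m) (h : 'rV[R]_n -> R).

Lemma derive_component f u v (a : 'I_m) : differentiable f u ->
  'D_v (fun w => f w 0 a) u = 'D_v f u 0 a.
Proof. by move=> df; rewrite derive_mx ?mxE//; exact: diff_derivable. Qed.

Lemma differentiable_component f u (a : 'I_m) : differentiable f u ->
  differentiable (fun w => f w 0 a) u.
Proof.
by move=> df; exact: (differentiable_comp df (differentiable_coord (f u) 0 a)).
Qed.

Lemma C1_component f (s : seq 'I_n) (a : 'I_m) : smooth_on U f ->
  C1_on U (fun u => foldr (@partial R n m) f s u 0 a).
Proof.
move=> sf.
apply: (@C1_near _ _ _ _ (fun v u => \sum_i v 0 i * foldr (@partial R n m) f (i :: s) u 0 a)) => //.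
- by move=> u Uu; apply: differentiable_component; exact: sf.
- move=> u v Uu; rewrite derive_sum_coord; last by apply: differentiable_component; exact: sf.
  by apply: eq_bigr => i _; rewrite derive_component//; exact: sf.
- move=> u v Uu; apply: continuous_at_sum => i _.
  apply: (@continuousM _ _ (cst (v 0 i))); first exact: cst_continuous.
  by apply/differentiable_continuous/differentiable_component; exact: (sf (i :: s)).
Qed.

Lemma partial_comm f (i j : 'I_n) u : smooth_on U f -> U u ->
  partial i (partial j f) u = partial j (partial i f) u.
Proof.
move=> sf Uu; apply/rowP => a.
have D (k : 'I_n) w : U w -> is_derive w (delta_mx 0 k) (fun z => f z 0 a) (partial k f w 0 a).
  move=> Uw; have df : differentiable f w := sf [::] w Uw.
  split; first exact/diff_derivable/differentiable_component.
  exact: derive_component.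
apply: etrans (esym (derive_component (delta_mx 0 i) a (sf [:: j] u Uu))) _.
apply: etrans _ (derive_component (delta_mx 0 j) a (sf [:: i] u Uu)).
apply: (derive_comm oU Uu (D j) (D i)).
  exact: (@C1_component f [:: j]).
exact: (@C1_component f [:: i]).
Qed.

Lemma is_derive_dot f g u v : differentiable f u -> differentiable g u ->
  is_derive u v (fun w => dot (f w) (g w)) (dot ('D_v f u) (g u) + dot (f u) ('D_v g u)).
Proof.
move=> df dg.
have H (a : 'I_m) : is_derive u v (fun w => f w 0 a * g w 0 a)
    ('D_v f u 0 a * g u 0 a + f u 0 a * 'D_v g u 0 a).
  have Hf : is_derive u v (fun w => f w 0 a) ('D_v f u 0 a).
    split; last exact: derive_component.
    exact/diff_derivable/differentiable_component.
  have Hg : is_derive u v (fun w => g w 0 a) ('D_v g u 0 a).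
    split; last exact: derive_component.
    exact/diff_derivable/differentiable_component.
  apply: (is_derive_eq (is_deriveM Hf Hg)).
  by rewrite /GRing.scale/= addrC mulrC.
have := @is_derive_bigsum _ _ u v _ (index_enum _) _ _ H.
rewrite big_split/= -!dotE; congr (is_derive _ _ _ _).
by apply/funext => w; rewrite dotE.
Qed.

Definition C1_vector f := forall a : 'I_m, C1_on U (fun u => f u 0 a).

Lemma C1_dot f g : C1_vector f -> C1_vector g -> C1_on U (fun u => dot (f u) (g u)).
Proof.
move=> cf cg; rewrite (_ : (fun u => _) = fun u => \sum_a f u 0 a * g u 0 a).
  apply: (@C1_sum _ _ U _ _ xpredT (fun a u => f u 0 a * g u 0 a) oU) => a _.
  exact: (C1_M oU (cf a) (cg a)).
by apply/funext => u; rewrite dotE.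
Qed.

End smooth.

Section surface.
Context {R : realType} {n : nat}.
Local Notation C := (closed_unit_ball R n).
Variables (U : set 'rV[R]_n) (x nu : 'rV[R]_n -> 'rV[R]_n.+1).
Hypotheses (oU : open U) (CU : C `<=` U).
Hypotheses (sx : smooth_on U x) (sn : smooth_on U nu).
Hypothesis nuP : forall u, C u ->
  enorm (nu u) = 1 /\ forall v, dot (nu u) ('D_v x u) = 0.
Hypothesis x_rank : forall u, C u -> \rank (jacobian x u) = n.

Definition tangent_frame m (f : 'rV[R]_n -> 'rV[R]_m) u : 'M[R]_(n, m) :=
  \matrix_(i, a) partial i f u 0 a.
Local Notation J := (tangent_frame x).
Local Notation K := (tangent_frame nu).

Lemma row_tangent_frame m (f : 'rV[R]_n -> 'rV[R]_m) i u :
  row i (tangent_frame f u) = partial i f u.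
Proof. by apply/rowP => a; rewrite !mxE. Qed.

Lemma tangent_frame_dot m (f g : 'rV[R]_n -> 'rV[R]_m) u i j :
  (tangent_frame f u *m (tangent_frame g u)^T) i j = dot (partial i f u) (partial j g u).
Proof. by rewrite mxE dotE; apply: eq_bigr => a _; rewrite !mxE. Qed.

Lemma tangent_frame_mulr m (f : 'rV[R]_n -> 'rV[R]_m) u v i :
  (tangent_frame f u *m v^T) i 0 = dot (partial i f u) v.
Proof. by rewrite mxE dotE; apply: eq_bigr => a _; rewrite !mxE. Qed.

Lemma metricE u : metric x u = J u *m (J u)^T.
Proof. by apply/matrixP => i j; rewrite tangent_frame_dot mxE. Qed.

Lemma C1_vector_partials f (s : seq 'I_n) : smooth_on U f ->
  C1_vector U (foldr (@partial R n n.+1) f s).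
Proof. by move=> sf a; exact: C1_component. Qed.

Lemma C1_dot_partials f g (s r : seq 'I_n) : smooth_on U f -> smooth_on U g ->
  C1_on U (fun u => dot (foldr (@partial R n n.+1) f s u) (foldr (@partial R n n.+1) g r u)).
Proof. by move=> sf sg; apply: (C1_dot oU); exact: C1_vector_partials. Qed.

Lemma interior_ball u : dot u u < 1 -> C u.
Proof. by rewrite /closed_unit_ball/= enorm_le1 => /ltW. Qed.

Lemma normal_unit u : C u -> nu u *m (nu u)^T = 1.
Proof.
move=> Cu; apply/matrixP => i j; rewrite !ord1 [RHS]mxE eqxx.
by have [/enorm_eq1] := nuP Cu.
Qed.

Lemma tangent_normal u : C u -> J u *m (nu u)^T = 0.
Proof.
move=> Cu; apply/matrixP => i j; rewrite ord1 tangent_frame_mulr mxE dotC.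
by have [_] := nuP Cu; apply.
Qed.

(** Derivative of |nu|^2 = 1, taken in the interior and extended to the boundary by continuity. *)
Lemma dot_dnormal_normal u v : C u -> dot (nu u) ('D_v nu u) = 0.
Proof.
move=> Cu; have dn w : U w -> differentiable nu w by exact: (sn [::]).
pose f w := dot (nu w) (nu w) - 1.
have fC : C1_on U f.
  by apply: (C1_D oU); [exact: (@C1_dot_partials _ _ [::] [::])|exact: C1_cst].
have df w : U w -> 'D_v f w = 2 * dot (nu w) ('D_v nu w).
  move=> Uw; have [] := is_deriveB (is_derive_dot v (dn w Uw) (dn w Uw)) (is_derive_cst (1 : R)
      w v).
  by move=> _ ->; rewrite subr0 [X in X + _]dotC -mulr2n mulr_natl.
have : 'D_v f u = 0.
  apply: (@ball_closure_eq0 R n ('D_v f) _ _ u Cu) => [w Cw|w w1]; first exact: (fC w (CU Cw)).2.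
  apply: (@open_ball_derive_eq0 R n f v _ w w1) => z /interior_ball Cz.
  by rewrite /f; have [/enorm_eq1 -> _] := nuP Cz; rewrite subrr.
by rewrite (df _ (CU Cu)) => /eqP; rewrite mulf_eq0 pnatr_eq0 => /eqP.
Qed.

Lemma dnormal_normal u : C u -> K u *m (nu u)^T = 0.
Proof.
move=> Cu; apply/matrixP => i j; rewrite ord1 tangent_frame_mulr mxE dotC.
exact: dot_dnormal_normal.
Qed.

(** Weingarten's equation: differentiating <nu, x_j> = 0 turns - <x_ij, nu> into <nu_i, x_j>. This
    fixes the sign with which [K] enters all later formulas. *)
Lemma second_fundamental_formE u : C u ->
  second_fundamental_form x nu u = K u *m (J u)^T.
Proof.
move=> Cu; apply/matrixP => i j; rewrite tangent_frame_dot mxE.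
pose f w := dot (nu w) (partial j x w).
pose g w := dot (partial i nu w) (partial j x w) + dot (nu w) (partial i (partial j x) w).
have gC : C1_on U g.
  apply: (C1_D oU); first exact: (@C1_dot_partials _ _ [:: i] [:: j]).
  exact: (@C1_dot_partials _ _ [::] [:: i; j]).
have : g u = 0.
  apply: (@ball_closure_eq0 R n g _ _ u Cu) => [w Cw|w w1].
    exact: C1_continuous gC (CU Cw).
  have Uw := CU (interior_ball w1).
  have [_ E] := is_derive_dot (delta_mx 0 i) (sn [::] Uw) (sx [:: j] Uw).
  apply: etrans (esym E) _.
  apply: (@open_ball_derive_eq0 R n f (delta_mx 0 i) _ w w1) => z /interior_ball Cz.
  by have [_] := nuP Cz; apply.
by rewrite /g (dotC (nu u)) => /eqP; rewrite addr_eq0 => /eqP ->.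
Qed.

Lemma second_fundamental_form_sym u : C u ->
  (second_fundamental_form x nu u)^T = second_fundamental_form x nu u.
Proof.
move=> Cu; apply/matrixP => i j; rewrite !mxE.
by rewrite (partial_comm oU _ _ sx (CU Cu)).
Qed.

Lemma jacobian_frame u : C u -> jacobian x u = J u.
Proof.
move=> Cu; apply/row_matrixP => i; rewrite row_tangent_frame.
by rewrite /partial deriveEjacobian ?rowE//; exact: (sx [::] (CU Cu)).
Qed.

Lemma metric_sym u : (metric x u)^T = metric x u.
Proof. by rewrite metricE trmx_mul trmxK. Qed.

Lemma metric_pos u (v : 'rV[R]_n) : C u -> v != 0 ->
  0 < (v *m metric x u *m v^T) 0 0.
Proof.
move=> Cu v0; rewrite metricE mulmxA -mulmxA -trmx_mul -/(dot _ _).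
rewrite lt0r dot_ge0 andbT; apply: contra_neq v0 => /dot_eq0 vJ.
have : row_free (J u) by rewrite /row_free -jacobian_frame// x_rank.
by move/row_freeP => [B JB]; rewrite -[v]mulmx1 -JB mulmxA vJ mul0mx.
Qed.

Lemma det_metric_neq0 u : C u -> \det (metric x u) != 0.
Proof.
move=> Cu; rewrite -unitfE -[_ \is a _]/(metric x u \in unitmx).
by apply: posdef_unitmx => v; exact: metric_pos.
Qed.

(* The normal comes first because the type 'M_(1 + n) of the matrix is then
   convertible to 'M_n.+1. *)
Definition frame_det u : R := \det (col_mx (nu u) (J u) : 'M[R]_(1 + n)).

(** The Gram matrix of the frame is block diagonal with blocks 1 and g. *)
Lemma frame_det_sqr u : C u -> frame_det u ^+ 2 = \det (metric x u).
Proof.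
move=> Cu; rewrite expr2 -[X in _ * X]det_tr -det_mulmx tr_col_mx mul_col_row.
rewrite normal_unit// tangent_normal// -metricE.
have -> : nu u *m (J u)^T = 0 by rewrite -[LHS]trmxK trmx_mul trmxK tangent_normal// trmx0.
by rewrite det_ublock det1 mul1r.
Qed.

Lemma frame_det_neq0 u : C u -> frame_det u != 0.
Proof. by move=> Cu; rewrite -sqrf_eq0 frame_det_sqr// det_metric_neq0. Qed.

(** Below the normal stand the coordinate tangent vectors of the parallel hypersurface x + t nu,
    with t as the indeterminate. *)
Definition frame_mx u : 'M[{poly R}]_(1 + n) :=
  col_mx (map_mx polyC (nu u)) (map_mx polyC (J u) + 'X *: map_mx polyC (K u)).

Definition frame_poly u : {poly R} := \det (frame_mx u).

Lemma horner_frame_mx u t :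
  map_mx (horner_eval t) (frame_mx u) = col_mx (nu u) (J u + t *: K u).
Proof.
rewrite map_col_mx; congr col_mx; apply/matrixP => i j; rewrite !mxE /horner_eval !hornerE//.
Qed.

Lemma horner_frame_poly u t :
  (frame_poly u).[t] = \det (col_mx (nu u) (J u + t *: K u) : 'M[R]_(1 + n)).
Proof. by rewrite -horner_frame_mx det_map_mx. Qed.

Lemma char_poly_shape_operator u : C u ->
  char_poly (shape_operator x nu u) =
  \prod_(i < n) ('X - (principal_curvatures x nu u 0 i)%:P).
Proof.
move=> Cu; pose P := [set kappa : 'rV[R]_n |
    char_poly (shape_operator x nu u) = \prod_(i < n) ('X - (kappa 0 i)%:P)].
have : P (xget 0 P); last by [].
apply: xgetPex; apply: pencil_char_poly_split.
- exact: second_fundamental_form_sym.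
- exact: metric_sym.
- by move=> v; exact: metric_pos.
Qed.

(** Multiplying the frame by the transpose of the frame at t = 0 gives a block triangular matrix
    with blocks 1 and g + t h = (1 + t S) g, S being the shape operator. Hence q(t) [frame_det] =
    det(1 + t S) [frame_det]^2. *)
Lemma coef_frame_poly u k : C u ->
  (frame_poly u)`_k = frame_det u * sigma x nu k u.
Proof.
move=> Cu; have D0 := frame_det_neq0 Cu.
have gU : metric x u \in unitmx by rewrite unitmxE unitfE det_metric_neq0.
have hS : shape_operator x nu u *m metric x u = K u *m (J u)^T.
  by rewrite /shape_operator -second_fundamental_formE// mulmxKV.
have eqt t : (frame_poly u).[t] * frame_det u =
    (\prod_(i < n) (1 + principal_curvatures x nu u 0 i *: 'X)).[t] * frame_det u ^+ 2.
  rewrite -(det_1DX_char_poly (char_poly_shape_operator Cu)) frame_det_sqr//.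
  rewrite horner_frame_poly -[X in _ * X]det_tr -det_mulmx tr_col_mx mul_col_row.
  rewrite normal_unit//.
  have -> : nu u *m (J u)^T = 0.
    by rewrite -[LHS]trmxK trmx_mul trmxK tangent_normal// trmx0.
  rewrite det_lblock det1 mul1r mulmxDl -scalemxAl -hS -metricE -[X in X + _]mul1mx.
  rewrite scalemxAl -mulmxDl det_mulmx -horner_evalE -det_map_mx; congr (\det _ * _).
  apply/matrixP => i j; rewrite 2![in RHS]mxE /= /horner_eval 2!mxE.
  by rewrite !mxE !hornerE hornerMn hornerE.
have key : frame_poly u = frame_det u *:
    \prod_(i < n) (1 + principal_curvatures x nu u 0 i *: 'X).
  apply/eqP; rewrite -subr_eq0; apply/eqP/poly_eq0_of_horner => t _.
  rewrite hornerD hornerN hornerZ; apply: (mulIf D0).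
  by rewrite mul0r mulrBl eqt expr2; ring.
by rewrite key coefZ coef_prod_1DX.
Qed.

(** * The flux field and its divergence *)

Section flux_field.
Variables (e : 'rV[R]_n.+1) (c : R).

Definition flux_field u : 'rV[R]_n.+1 :=
  conformal_field e (x u) + c *: (dot (nu u) e *: x u - dot (x u) (nu u) *: e).

Definition weight u : R := dot (x u) e + c * dot (nu u) e.

Definition rotation u : 'M[R]_n.+1 := e^T *m x u - (x u)^T *m e.

Lemma rotation_skew u : (rotation u)^T = - rotation u.
Proof. by rewrite /rotation linearB /= !trmx_mul !trmxK opprB. Qed.

Lemma mul_rotation u v : v *m rotation u = dot v e *: x u - dot v (x u) *: e.
Proof.
rewrite mulmxBr !mulmxA; congr (_ - _); apply/rowP => a.
  by rewrite [LHS]mxE big_ord_recl big_ord0 addr0 !mxE dotE; congr (_ * _); apply: eq_bigr => b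
      _; rewrite mxE.
by rewrite [LHS]mxE big_ord_recl big_ord0 addr0 !mxE dotE; congr (_ * _); apply: eq_bigr => b _;
    rewrite mxE.
Qed.

Lemma flux_fieldE u a : flux_field u 0 a =
  dot (x u) e * x u 0 a - 2^-1 * (dot (x u) (x u) + 1) * e 0 a +
  c * (dot (nu u) e * x u 0 a - dot (x u) (nu u) * e 0 a).
Proof. by rewrite !mxE enorm_sqr. Qed.

Lemma dot_flux_field_normal u :
  dot (flux_field u) (nu u) = dot (conformal_field e (x u)) (nu u).
Proof.
rewrite /flux_field dotDl dotZl.
have -> : dot (dot (nu u) e *: x u - dot (x u) (nu u) *: e) (nu u) = 0.
  by rewrite dotDl dotNl !dotZl (dotC e) mulrC subrr.
by rewrite mulr0 addr0.
Qed.

Let dx u : U u -> differentiable x u. Proof. exact: (sx [::]). Qed.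
Let dnu u : U u -> differentiable nu u. Proof. exact: (sn [::]). Qed.

Lemma C1_x a : C1_on U (fun u => x u 0 a). Proof. exact: (C1_vector_partials [::] sx). Qed.
Lemma C1_nu a : C1_on U (fun u => nu u 0 a). Proof. exact: (C1_vector_partials [::] sn). Qed.
Lemma C1_dx i a : C1_on U (fun u => partial i x u 0 a).
Proof. exact: (C1_vector_partials [:: i] sx). Qed.
Lemma C1_dnu i a : C1_on U (fun u => partial i nu u 0 a).
Proof. exact: (C1_vector_partials [:: i] sn). Qed.

Let C1_vector_cst (w : 'rV[R]_n.+1) : C1_vector U (cst w). Proof. by move=> a; exact: C1_cst. Qed.

Lemma C1_weight : C1_on U weight.
Proof.
apply: (C1_D oU); first exact: (C1_dot oU C1_x (C1_vector_cst e)).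
exact: (C1_M oU (@C1_cst _ _ U c) (C1_dot oU C1_nu (C1_vector_cst e))).
Qed.

Lemma C1_flux_field a : C1_on U (fun u => flux_field u 0 a).
Proof.
rewrite (_ : (fun u => _) = (fun u =>
  dot (x u) e * x u 0 a - 2^-1 * (dot (x u) (x u) + 1) * e 0 a +
  c * (dot (nu u) e * x u 0 a - dot (x u) (nu u) * e 0 a))); last first.
  by apply/funext => u; exact: flux_fieldE.
have cst r : C1_on U (fun _ : 'rV[R]_n => r) := @C1_cst _ _ U r.
have xe := C1_dot oU C1_x (C1_vector_cst e); have ne := C1_dot oU C1_nu (C1_vector_cst e).
have xx := C1_dot oU C1_x C1_x; have xn := C1_dot oU C1_x C1_nu.
apply: (C1_D oU).
  apply: (C1_D oU (C1_M oU xe (C1_x a))); apply: (C1_N oU).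
  exact: (C1_M oU (C1_M oU (cst _) (C1_D oU xx (cst 1))) (cst (e 0 a))).
apply: (C1_M oU (cst c)); apply: (C1_D oU (C1_M oU ne (C1_x a))); apply: (C1_N oU).
exact: (C1_M oU xn (cst (e 0 a))).
Qed.

Definition dflux_field i u : 'rV[R]_n.+1 :=
  weight u *: partial i x u + row i ((J u + c *: K u) *m rotation u).

(** X_e contributes <x, e> x_i and the rotation of x_i; the correction contributes c <nu, e> x_i and
    c times the rotation of nu_i, because <x_i, nu> = 0. *)
Lemma is_derive_flux_field i u a : C u ->
  is_derive u (delta_mx 0 i) (fun w => flux_field w 0 a) (dflux_field i u 0 a).
Proof.
move=> Cu; have Uu := CU Cu.
have der f b : differentiable f u -> is_derive u (delta_mx 0 i) (fun w => (f w : 'rV[R]_n.+1) 0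
    b) (partial i f u 0 b).
  move=> df; split; last exact: derive_component.
  exact/diff_derivable/differentiable_component.
have dc : differentiable (cst e : 'rV[R]_n -> 'rV[R]_n.+1) u by exact: differentiable_cst.
have De : 'D_(delta_mx 0 i) (cst e : 'rV[R]_n -> 'rV[R]_n.+1) u = 0 by exact: derive_cst.
have xe := is_derive_dot (delta_mx 0 i) (dx Uu) dc.
have ne := is_derive_dot (delta_mx 0 i) (dnu Uu) dc.
have xx := is_derive_dot (delta_mx 0 i) (dx Uu) (dx Uu).
have xn := is_derive_dot (delta_mx 0 i) (dx Uu) (dnu Uu).
have xa := der x a (dx Uu).
have cstR (r : R) := is_derive_cst r u (delta_mx 0 i).
rewrite (_ : (fun w => _) =
  (fun w => dot (x w) e) * (fun w => x w 0 a)
  - cst 2^-1 * ((fun w => dot (x w) (x w)) + cst 1) * cst (e 0 a)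
  + cst c * ((fun w => dot (nu w) e) * (fun w => x w 0 a)
    - (fun w => dot (x w) (nu w)) * cst (e 0 a))); last first.
  by apply/funext => w; rewrite flux_fieldE.
have H1 := is_deriveM xe xa.
have H2 := is_deriveM (is_deriveM (cstR 2^-1) (is_deriveD xx (cstR 1))) (cstR (e 0 a)).
have H3 := is_deriveM (cstR c) (is_deriveB (is_deriveM ne xa) (is_deriveM xn (cstR (e 0 a)))).
apply: (is_derive_eq (is_deriveD (is_deriveB H1 H2) H3)).
have xn0 : dot (partial i x u) (nu u) = 0.
  by rewrite dotC; have [_] := nuP Cu; apply.
have -> : dflux_field i u 0 a = weight u * partial i x u 0 a
    + (dot (partial i x u + c *: partial i nu u) e * x u 0 a
       - dot (partial i x u + c *: partial i nu u) (x u) * e 0 a).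
  rewrite /dflux_field row_mul.
  have -> : row i (J u + c *: K u) = partial i x u + c *: partial i nu u.
    by apply/rowP => b; rewrite !mxE.
  by rewrite mul_rotation !mxE.
rewrite De -!/(partial i x u) -!/(partial i nu u) /GRing.scale/= !fctE /cst /weight.
rewrite !dotDl !dotZl xn0 (dotC (x u) (partial i x u)) (dotC (x u) (partial i nu u)).
have -> : dot (x u) 0 = 0 by rewrite dotE big1// => ? _; rewrite mxE mulr0.
have -> : dot (nu u) 0 = 0 by rewrite dotE big1// => ? _; rewrite mxE mulr0.
move: (dot (x u) e) (dot (nu u) e) (dot (partial i x u) e) (dot (partial i nu u) e).
move: (dot (x u) (x u)) (dot (x u) (nu u)) (dot (partial i x u) (x u)).
move: (dot (partial i nu u) (x u)) (partial i x u 0 a) (x u 0 a) (e 0 a).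
by move=> *; field.
Qed.

Local Notation lift0 i := (lift ord0 i : 'I_(1 + n)).

Definition frame_at t u : 'M[R]_(1 + n) := col_mx (nu u) (J u + t *: K u).

Definition flux_component t i u : R :=
  \det (set_row (frame_at t u) (lift0 i) (flux_field u)).

Definition frame_second t i j u : 'rV[R]_n.+1 :=
  partial i (partial j x) u + t *: partial i (partial j nu) u.

Lemma frame_second_sym t i j u : U u -> frame_second t i j u = frame_second t j i u.
Proof.
by move=> Uu; rewrite /frame_second (partial_comm oU i j sx Uu) (partial_comm oU i j sn Uu).
Qed.

Lemma C1_frame_at t a b : C1_on U (fun u => frame_at t u a b).
Proof.
case: (unliftP ord0 a) => [j ->|->].
  rewrite (_ : (fun u => _) = fun u => partial j x u 0 b + t * partial j nu u 0 b).
    apply: (C1_D oU (C1_dx j b)).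
    exact: (C1_M oU (@C1_cst _ _ U t) (C1_dnu j b)).
  by apply/funext => u; rewrite /frame_at frame_entryS !mxE.
rewrite (_ : (fun u => _) = fun u => nu u 0 b); first exact: C1_nu.
by apply/funext => u; rewrite /frame_at frame_entry0.
Qed.

Lemma C1_flux_component t i : C1_on U (flux_component t i).
Proof.
apply: (C1_det oU) => a b.
have [ai|ai] := eqVneq a (lift0 i).
  rewrite (_ : (fun u => _) = fun u => flux_field u 0 b); first exact: C1_flux_field.
  by apply/funext => u; rewrite mxE ai eqxx.
rewrite (_ : (fun u => _) = fun u => frame_at t u a b); first exact: C1_frame_at.
by apply/funext => u; rewrite mxE (negPf ai).
Qed.

Lemma sum_antisym (T : 'I_n -> 'I_n -> R) :
  (forall i j, i != j -> T i j = - T j i) -> \sum_i \sum_(j | j != i) T i j = 0.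
Proof.
move=> Tas; set s := \sum_i _; have : s = - s.
  rewrite [in RHS]/s (exchange_big_dep xpredT)//= -sumrN; apply: eq_bigr => j _.
  rewrite -sumrN; apply: eq_big => [i|i ij]; first by rewrite eq_sym.
  by rewrite Tas 1?eq_sym.
by move/eqP; rewrite -addr_eq0 -mulr2n mulrn_eq0 => /eqP.
Qed.

(** Exchanging i and j swaps two rows of the determinant while [Y] stays the same, so the summand is
    antisymmetric. *)
Lemma sum_det_second_eq0 (A : 'M[R]_(1 + n)) (F : 'rV[R]_n.+1) (Y : 'I_n -> 'I_n -> 'rV[R]_n.+1) :
  (forall i j, Y i j = Y j i) ->
  \sum_i \sum_(j | j != i) \det (set_row (set_row A (lift0 i) F) (lift0 j) (Y i j)) = 0.
Proof.
move=> Ysym; apply: sum_antisym => i j ij.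
have ij' : lift0 i != lift0 j by rewrite (inj_eq (@lift_inj _ _)).
by rewrite det_set_row_swap// set_rowC// Ysym.
Qed.

Lemma derive_flux_component t i u : C u ->
  'D_(delta_mx 0 i) (flux_component t i) u =
  \det (set_row (set_row (frame_at t u) (lift0 i) (flux_field u)) ord0 (partial i nu u))
  + (\det (set_row (frame_at t u) (lift0 i) (dflux_field i u))
  + \sum_(j | j != i) \det (set_row (set_row (frame_at t u) (lift0 i) (flux_field u))
      (lift0 j) (frame_second t i j u))).
Proof.
move=> Cu; have Uu := CU Cu.
pose dA : 'M[R]_(1 + n) := set_row (col_mx (partial i nu u)
  (\matrix_(j, a) frame_second t i j u 0 a)) (lift0 i) (dflux_field i u).
have der f b : differentiable f u ->
    is_derive u (delta_mx 0 i) (fun w => (f w : 'rV[R]_n.+1) 0 b) (partial i f u 0 b).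
  move=> df; split; last exact: derive_component.
  exact/diff_derivable/differentiable_component.
have H a b : is_derive u (delta_mx 0 i)
    (fun w => set_row (frame_at t w) (lift0 i) (flux_field w) a b) (dA a b).
  have [ai|ai] := eqVneq a (lift0 i).
    rewrite (_ : (fun w => _) = fun w => flux_field w 0 b).
      by rewrite mxE ai eqxx; exact: is_derive_flux_field.
    by apply/funext => w; rewrite mxE ai eqxx.
  rewrite (_ : (fun w => _) = fun w => frame_at t w a b); last first.
    by apply/funext => w; rewrite mxE (negPf ai).
  rewrite mxE (negPf ai); case: (unliftP ord0 a) => [j ->|->].
    rewrite (_ : (fun w => _) =
        (fun w => partial j x w 0 b) + (fun w => t * partial j nu w 0 b)).
      rewrite frame_entryS mxE (_ : frame_second t i j u 0 b =
        partial i (partial j x) u 0 b + t * partial i (partial j nu) u 0 b); last by rewrite !mxE.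
      have Dx := der (partial j x) b (sx [:: j] Uu).
      have Dn := der (partial j nu) b (sn [:: j] Uu).
      exact: (is_deriveD Dx (is_deriveZ t Dn)).
    by apply/funext => w; rewrite /frame_at frame_entryS !mxE.
  rewrite (_ : (fun w => _) = fun w => nu w 0 b).
    by rewrite frame_entry0; exact: der (dnu Uu).
  by apply/funext => w; rewrite /frame_at frame_entry0.
have [_ ->] := is_derive_det H.
rewrite big_ord_recl; congr (\det (set_row _ _ _) + _).
  rewrite row_set_row_neq ?row_frame0//; exact: neq_lift.
rewrite (bigD1 i)//= row_set_row set_row_id; congr (_ + _).
apply: eq_bigr => j ji; congr (\det (set_row _ _ _)).
rewrite row_set_row_neq; last by rewrite (inj_eq (@lift_inj _ _)).
by rewrite row_frameS; apply/rowP => a; rewrite !mxE.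
Qed.

Lemma sum_frame_dnormal t u :
  \sum_i \det (set_row (frame_at t u) (lift0 i) (row i (K u))) = (frame_poly u)^`().[t].
Proof.
have H a b : is_derive t (1 : R) (fun s => frame_at s u a b)
    ((col_mx 0 (K u) : 'M[R]_(1 + n)) a b).
  case: (unliftP ord0 a) => [j ->|->].
    rewrite (_ : (fun w => _) = cst (J u j b) + (fun s => K u j b * s)).
      have D1 := is_derive_cst (J u j b) t (1 : R).
      apply: (is_derive_eq (is_deriveD D1 (is_deriveZ (K u j b) (is_derive_id t (1 : R))))).
      by rewrite frame_entryS add0r /GRing.scale/= mulr1.
    by apply/funext => w; rewrite /frame_at frame_entryS !mxE mulrC.
  rewrite (_ : (fun w => _) = cst (nu u 0 b)).
    by rewrite frame_entry0 mxE; exact: is_derive_cst.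
  by apply/funext => w; rewrite /frame_at frame_entry0.
have [_ E] := is_derive_det H.
have [_ E'] := is_derive_poly (frame_poly u) t.
rewrite -E' (_ : horner (frame_poly u) = fun s => \det (frame_at s u)); last first.
  by apply/funext => s; rewrite horner_frame_poly.
rewrite E big_ord_recl row_frame0 -[X in set_row _ _ X](scale0r 0) det_set_rowZ mul0r add0r.
by apply: eq_bigr => i _; rewrite row_frameS.
Qed.

(** Write x_i = (x_i + t nu_i) - t nu_i: the first part restores the frame in each of the n slots,
    the second gives - t q'. *)
Lemma sum_frame_tangent t u :
  \sum_i \det (set_row (frame_at t u) (lift0 i) (row i (J u))) =
  (n%:R *: frame_poly u - 'X * (frame_poly u)^`()).[t].
Proof.
rewrite hornerD hornerN hornerZ hornerM hornerX -sum_frame_dnormal horner_frame_poly.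
have E i : \det (set_row (frame_at t u) (lift0 i) (row i (J u))) =
    \det (frame_at t u) - t * \det (set_row (frame_at t u) (lift0 i) (row i (K u))).
  have -> : row i (J u) = row (lift0 i) (frame_at t u) + (- t) *: row i (K u).
    by rewrite row_frameS; apply/rowP => a; rewrite !mxE; ring.
  by rewrite det_set_rowD det_set_rowZ set_row_row mulNr.
apply: etrans (eq_bigr _ (fun i _ => E i)) _.
by rewrite sumrB sumr_const card_ord -mulr_sumr mulr_natl.
Qed.

Definition divergence_poly u : {poly R} :=
  weight u *: (n%:R *: frame_poly u - 'X * (frame_poly u)^`())
  - dot (conformal_field e (x u)) (nu u) *: (frame_poly u)^`().

(* The cancellation of the second derivatives replaces the Codazzi equation. *)
Lemma divergence_flux_component t u : t != 0 -> C u ->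
  \sum_i 'D_(delta_mx 0 i) (flux_component t i) u = (divergence_poly u).[t].
Proof.
move=> t0 Cu; have Uu := CU Cu.
under eq_bigr do rewrite derive_flux_component//.
rewrite !big_split/=.
have Y0 := sum_det_second_eq0 (frame_at t u) (flux_field u)
  (fun i j => @frame_second_sym t i j u Uu).
rewrite [X in _ + (_ + X)](Y0) addr0.
have nu1 := normal_unit Cu; have Jn := tangent_normal Cu; have Kn := dnormal_normal Cu.
have KJ : (K u *m (J u)^T)^T = K u *m (J u)^T.
  by rewrite -second_fundamental_formE// second_fundamental_form_sym.
rewrite /divergence_poly hornerD hornerN !hornerZ -sum_frame_dnormal -sum_frame_tangent.
(* The derivative of the slot [F] gives the summand with [weight]; the derivative of the row nu
   gives the one with <X_e, nu>. *)
rewrite addrC; congr (_ + _).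
  under eq_bigr do rewrite det_set_rowD det_set_rowZ -row_tangent_frame.
  rewrite big_split/= -mulr_sumr.
  by rewrite (sum_frame_skew c nu1 Jn Kn KJ t0 (frame_det_neq0 Cu) (rotation_skew u)) addr0.
rewrite -dot_flux_field_normal mulr_sumr -sumrN; apply: eq_bigr => i _.
by rewrite -row_tangent_frame frame_normal_part.
Qed.

Lemma derive_tangent_frame m (f : 'rV[R]_n -> 'rV[R]_m) u v : differentiable f u ->
  'D_v f u = v *m tangent_frame f u.
Proof.
move=> df; apply/rowP => a; apply: etrans (esym (derive_component v a df)) _.
rewrite derive_sum_coord; last exact: differentiable_component.
by rewrite mxE; apply: eq_bigr => i _; rewrite derive_component// mxE.
Qed.

(** The part of [q] orthogonal to [u] is itself tangent to the sphere, so [q] annihilates it and its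
    square norm is 0. *)
Lemma col_proportional (u : 'rV[R]_n) (q : 'cV[R]_n) : dot u u = 1 ->
  (forall v, dot u v = 0 -> v *m q = 0) -> q = (u *m q) 0 0 *: u^T.
Proof.
move=> u1 qP; pose s := dot u q^T; pose v := q^T - s *: u.
have sE : (u *m q) 0 0 = s by rewrite /s /dot trmxK.
have uv : dot u v = 0 by rewrite dotDr dotNr dotZr u1 mulr1 subrr.
have vq : dot v q^T = 0 by rewrite /dot trmxK qP// mxE.
have : v = 0.
  apply: dot_eq0; rewrite {2}/v dotDr dotNr dotZr vq (dotC v) uv.
  by rewrite mulr0 subr0.
move=> /subr0_eq E; rewrite sE -[LHS]trmxK E.
by rewrite linearZ.
Qed.

Lemma map_set_row (A B : nzRingType) (g : A -> B) k (M : 'M[A]_k) i (v : 'rV[A]_k) :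
  map_mx g (set_row M i v) = set_row (map_mx g M) i (map_mx g v).
Proof. by apply/matrixP => a b; rewrite !mxE; case: eqP. Qed.

(** * Vanishing of the flux on the sphere *)

Hypothesis x_sphere : forall u, dot u u = 1 -> dot (x u) (x u) = 1.
Hypothesis x_capillary : forall u, dot u u = 1 -> dot (nu u) (x u) = - c.
Hypothesis c_lt1 : c ^+ 2 < 1.

Let sphere_ball u : dot u u = 1 -> C u.
Proof. by move=> u1; rewrite /closed_unit_ball/= enorm_le1 u1. Qed.

(** Derivatives of |x|^2 = 1 and <nu, x> = - c along the sphere. The second one expresses that the
    conormal of a boundary with constant contact angle is a principal direction. *)
Lemma sphere_tangent_orthogonal u v : dot u u = 1 -> dot u v = 0 ->
  dot ('D_v x u) (x u + c *: nu u) = 0 /\ dot ('D_v nu u) (x u + c *: nu u) = 0.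
Proof.
move=> u1 uv; have Cu := sphere_ball u1; have Uu := CU Cu.
have nx : dot (nu u) ('D_v x u) = 0 by have [_] := nuP Cu; apply.
have nn := dot_dnormal_normal v Cu.
have [H1 E1] := is_derive_dot v (dx Uu) (dx Uu).
have [H2 E2] := is_derive_dot v (dnu Uu) (dx Uu).
have cxx := C1_dot oU C1_x C1_x; have cnx := C1_dot oU C1_nu C1_x.
have := sphere_tangent_derive (cxx u Uu).1 u1 uv x_sphere.
have := sphere_tangent_derive (cnx u Uu).1 u1 uv x_capillary.
rewrite E1 E2 nx addr0 => nx0 /eqP.
rewrite (dotC (x u)) -mulr2n mulrn_eq0 => /eqP xx0.
by rewrite !dotDr !dotZr (dotC _ (nu u)) nx (dotC _ (nu u)) nn xx0 nx0 mulr0 addr0.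
Qed.

(** On the sphere <F, nu> = - (<nu, e> + c <x, e>) and <F, x> = c (<nu, e> + c <x, e>). This balance
    determines the coefficient of the correction in [flux_field]. *)
Lemma flux_field_sphere u : dot u u = 1 -> dot (flux_field u) (x u + c *: nu u) = 0.
Proof.
move=> u1; have Cu := sphere_ball u1.
have nn : dot (nu u) (nu u) = 1 by have [/enorm_eq1] := nuP Cu.
have xx := x_sphere u1; have nx := x_capillary u1.
rewrite dotDr dotZr dot_flux_field_normal /flux_field /conformal_field.
rewrite enorm_sqr !(dotDl, dotNl, dotZl) xx (dotC e (x u)) (dotC e (nu u)) (dotC (x u) (nu u)) nx.
by move: (dot (x u) e) (dot (nu u) e) => p q; field.
Qed.

(** The vector p = x + c nu is orthogonal to nu and to F, while J p and K p are multiples of [u],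
    since directions tangent to the sphere annihilate them. It is nonzero because |p|^2 = 1 - c^2,
    so [flux_eq0] applies. *)
Lemma flux_component_sphere t u : dot u u = 1 ->
  \sum_i u 0 i * flux_component t i u = 0.
Proof.
move=> u1; have Cu := sphere_ball u1; have Uu := CU Cu.
pose p : 'rV[R]_n.+1 := x u + c *: nu u.
have Jp v : dot u v = 0 -> v *m (J u *m p^T) = 0.
  move=> uv; apply/rowP => i; rewrite ord1 [RHS]mxE mulmxA -derive_tangent_frame; last exact: dx.
  by have [] := sphere_tangent_orthogonal u1 uv.
have Kp v : dot u v = 0 -> v *m (K u *m p^T) = 0.
  move=> uv; apply/rowP => i; rewrite ord1 [RHS]mxE mulmxA -derive_tangent_frame; last exact: dnu.
  by have [] := sphere_tangent_orthogonal u1 uv.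
have nn : dot (nu u) (nu u) = 1 by have [/enorm_eq1] := nuP Cu.
have np : nu u *m p^T = 0.
  apply/rowP => i; rewrite ord1 [RHS]mxE -[LHS]/(dot (nu u) p).
  by rewrite dotDr dotZr nn x_capillary// mulr1 addNr.
have pp : dot p p = 1 - c ^+ 2.
  rewrite !(dotDl, dotDr, dotZl, dotZr) nn (dotC (x u) (nu u)) x_capillary// x_sphere//.
  by ring.
have p0 : map_mx polyC p^T != 0.
  apply: contraTneq c_lt1 => /matrixP p0; rewrite -leNgt -subr_le0 -pp dotE big1// => i _.
  by have := p0 i 0; rewrite 2!mxE [RHS]mxE => /eqP; rewrite polyC_eq0 => /eqP ->; rewrite mul0r.
(* The value at t = 0 is [frame_det], so the polynomial is nonzero even if it vanishes at the given
   [t]. *)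
have d0 : \det (frame_mx u) != 0.
  apply: contraNneq (frame_det_neq0 Cu) => d0.
  have := horner_frame_poly u 0; rewrite /frame_poly d0 horner0 scale0r addr0 => E.
  by rewrite /frame_det -E.
have Fp : map_mx polyC (flux_field u) *m map_mx polyC p^T = 0.
  rewrite -map_mxM (_ : flux_field u *m p^T = 0) ?map_mx0//.
  by apply/rowP => i; rewrite ord1 [RHS]mxE; exact: flux_field_sphere.
have [al Ja] : exists al, J u *m p^T = al *: u^T.
  by eexists; exact: (col_proportional u1 Jp).
have [be Kb] : exists be, K u *m p^T = be *: u^T.
  by eexists; exact: (col_proportional u1 Kp).
have Mp : frame_mx u *m map_mx polyC p^T =
    (al%:P + 'X * be%:P) *: (row_mx 0 (map_mx polyC u))^T.
  rewrite /frame_mx mul_col_mx -map_mxM np map_mx0 tr_row_mx scale_col_mx trmx0 scaler0.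
  rewrite mulmxDl -scalemxAl -!map_mxM Ja Kb.
  by congr col_mx; rewrite !map_mxZ map_trmx scalerA -scalerDl.
have := flux_eq0 d0 p0 Fp Mp => /(congr1 (fun q : {poly R} => q.[t])).
rewrite horner_sum horner0 => E; apply: etrans _ E; apply: eq_bigr => i _.
have ev (B : 'M[{poly R}]_(1 + n)) : (\det B).[t] = \det (map_mx (horner_eval t) B).
  by rewrite det_map_mx.
rewrite hornerM ev map_set_row horner_frame_mx mxE hornerC.
congr (_ * \det (set_row _ _ _)).
by apply/rowP => a; rewrite !mxE /horner_eval hornerC.
Qed.

(** * Coefficients in t: regularity and integrals *)

Definition polyC1 (f : 'rV[R]_n -> {poly R}) := forall k, C1_on U (fun u => (f u)`_k).

Lemma polyC1_M f g : polyC1 f -> polyC1 g -> polyC1 (fun u => f u * g u).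
Proof.
move=> cf cg k.
rewrite (_ : (fun u => _) = fun u => \sum_(j < k.+1) (f u)`_j * (g u)`_(k - j)).
  apply: (@C1_sum _ _ U _ _ xpredT (fun (j : 'I_k.+1) u => (f u)`_j * (g u)`_(k - j)) oU) => j _.
  exact: (C1_M oU (cf j) (cg _)).
by apply/funext => u; rewrite coefM.
Qed.

Lemma polyC1_D f g : polyC1 f -> polyC1 g -> polyC1 (fun u => f u + g u).
Proof.
move=> cf cg k; rewrite (_ : (fun u => _) = fun u => (f u)`_k + (g u)`_k).
  exact: (C1_D oU (cf k) (cg k)).
by apply/funext => u; rewrite coefD.
Qed.

Lemma polyC1_cst p : polyC1 (cst p).
Proof. by move=> k; exact: (@C1_cst _ _ U p`_k). Qed.

Lemma polyC1_polyC (f : 'rV[R]_n -> R) : C1_on U f -> polyC1 (fun u => (f u)%:P).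
Proof.
move=> cf [|k].
  rewrite (_ : (fun u => _) = f)//.
  by apply/funext => u; rewrite coefC.
rewrite (_ : (fun u => _) = cst 0); first exact: C1_cst.
by apply/funext => u; rewrite coefC.
Qed.

Lemma polyC1_sum I (r : seq I) (F : I -> 'rV[R]_n -> {poly R}) :
  (forall i, polyC1 (F i)) -> polyC1 (fun u => \sum_(i <- r) F i u).
Proof.
move=> cF k; rewrite (_ : (fun u => _) = fun u => \sum_(i <- r) (F i u)`_k).
  by apply: (@C1_sum _ _ U _ _ xpredT (fun i u => (F i u)`_k) oU) => i _; exact: cF.
by apply/funext => u; rewrite coef_sum.
Qed.

Lemma polyC1_prod I (r : seq I) (F : I -> 'rV[R]_n -> {poly R}) :
  (forall i, polyC1 (F i)) -> polyC1 (fun u => \prod_(i <- r) F i u).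
Proof.
move=> cF; elim: r => [|i r IHr].
  rewrite (_ : (fun u => _) = cst 1); first exact: polyC1_cst.
  by apply/funext => u; rewrite big_nil.
rewrite (_ : (fun u => _) = fun u => F i u * \prod_(j <- r) F j u).
  exact: polyC1_M.
by apply/funext => u; rewrite big_cons.
Qed.

(** Together with [coef_frame_poly], this is the source of continuity and integrability for the
    curvature integrands. *)
Lemma C1_coef_frame_poly k : C1_on U (fun u => (frame_poly u)`_k).
Proof.
suff : polyC1 frame_poly by [].
apply: polyC1_sum => s; apply: polyC1_M; first exact: polyC1_cst.
apply: polyC1_prod => a.
case: (unliftP ord0 a) => [j ->|->].
  rewrite (_ : (fun u => _) = fun u => (partial j x u 0 (s (lift ord0 j)))%:P
      + 'X * (partial j nu u 0 (s (lift ord0 j)))%:P).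
    apply: polyC1_D; first exact/polyC1_polyC/C1_dx.
    by apply: polyC1_M; [exact: polyC1_cst|exact/polyC1_polyC/C1_dnu].
  by apply/funext => u; rewrite /frame_mx frame_entryS !mxE.
rewrite (_ : (fun u => _) = fun u => (nu u 0 (s ord0))%:P).
  exact/polyC1_polyC/C1_nu.
by apply/funext => u; rewrite /frame_mx frame_entry0 mxE.
Qed.

Definition support_normal u : R := dot (conformal_field e (x u)) (nu u).

Lemma C1_support_normal : C1_on U support_normal.
Proof.
rewrite (_ : support_normal = fun u => dot (flux_field u) (nu u)); last first.
  by apply/funext => u; rewrite dot_flux_field_normal.
exact: (C1_dot oU C1_flux_field C1_nu).
Qed.

Lemma coef_divergence_poly u k : (divergence_poly u)`_k =
  (n%:R - k%:R) * (weight u * (frame_poly u)`_k)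
  - k.+1%:R * (support_normal u * (frame_poly u)`_k.+1).
Proof.
rewrite /divergence_poly /support_normal.
move: (frame_poly u) (weight u) (dot _ _) => q w d.
have der j : (q^`())`_j = j.+1%:R * q`_j.+1 by rewrite coef_deriv mulr_natl.
rewrite !(coefD, coefN, coefZ, coefXM) der.
by case: k => [|k] /=; rewrite ?der; ring.
Qed.

Lemma coef_frame_poly_eq0 u k : C u -> (n < k)%N -> (frame_poly u)`_k = 0.
Proof. by move=> Cu nk; rewrite coef_frame_poly// /sigma mpoly.mesym_geqnE// mpoly.meval0 mulr0.
    Qed.

(** In degree n the factor n - n kills the first term; in higher degrees the coefficients of q
    vanish. So n coefficients describe the divergence at every point. *)
Lemma size_divergence_poly u : C u -> (size (divergence_poly u) <= n)%N.
Proof.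
move=> Cu; apply/leq_sizeP => j nj; rewrite coef_divergence_poly.
rewrite (@coef_frame_poly_eq0 u j.+1)// !mulr0 subr0.
move: nj; rewrite leq_eqVlt => /orP[/eqP->|nj]; first by rewrite subrr mul0r.
by rewrite coef_frame_poly_eq0// !mulr0.
Qed.

Let cdiv k u : C u -> {for u, continuous (fun w => (divergence_poly w)`_k)}.
Proof.
move=> Cu; rewrite (_ : (fun w => _) = fun w =>
  (n%:R - k%:R) * (weight w * (frame_poly w)`_k)
  - k.+1%:R * (support_normal w * (frame_poly w)`_k.+1)); last first.
  by apply/funext => w; exact: coef_divergence_poly.
have cst r : C1_on U (fun _ : 'rV[R]_n => r) := @C1_cst _ _ U r.
have A := C1_M oU (cst (n%:R - k%:R)) (C1_M oU C1_weight (C1_coef_frame_poly k)).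
have B := C1_M oU (cst k.+1%:R) (C1_M oU C1_support_normal (C1_coef_frame_poly k.+1)).
exact: (C1_continuous (C1_D oU A (C1_N oU B)) (CU Cu)).
Qed.

(** The polynomial whose coefficients are these integrals takes at each t != 0 the value of the
    integrated divergence, which is 0; hence it is the zero polynomial. *)
Lemma integral_coef_divergence_poly (k : 'I_n) :
  \int[leb n]_(t in @ball_tuples R n) (divergence_poly (row_of t))`_k = 0.
Proof.
have mB := @measurable_ball_tuples R n.
pose I (j : nat) := \int[leb n]_(t in @ball_tuples R n) (divergence_poly (row_of t))`_j.
have ic j : (leb n).-integrable (@ball_tuples R n) (fun t => ((divergence_poly (row_of t))`_j)%:E).
  exact: (@integrable_continuous_ball R n _ (@cdiv j)).
have IE j : (\int[leb n]_(t in @ball_tuples R n) ((divergence_poly (row_of t))`_j)%:E)%E = (I j)%:E.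
  by rewrite /I /Rintegral fineK//; exact: integrable_fin_num.
have P0 (t : R) : t != 0 -> (\poly_(j < n) I j).[t] = 0.
  move=> t0; rewrite horner_poly; apply: EFin_inj.
  rewrite -[RHS](@divergence_zero_flux R n U (flux_component t) oU CU
    (C1_flux_component t) (flux_component_sphere t) k).
  transitivity (\int[leb n]_(s in @ball_tuples R n)
    (\sum_(j < n) ((t ^+ j)%:E * ((divergence_poly (row_of s))`_j)%:E)))%E; last first.
    apply: eq_integral => s /[!inE] Cs.
    rewrite (divergence_flux_component t0 Cs) (horner_coef_wide _ (size_divergence_poly Cs)).
    by rewrite -sumEFin; apply: eq_bigr => j _; rewrite mulrC EFinM.
  rewrite integral_sum//; last by move=> j; exact: integrableZl.
  rewrite -sumEFin; apply: eq_bigr => j _.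
  by rewrite integralZl// IE -EFinM mulrC.
have := poly_eq0_of_horner P0 => /(congr1 (fun p : {poly R} => p`_k)).
by rewrite coef_poly ltn_ord coef0.
Qed.

(** * Orientation, area element and conclusion *)

Lemma frame_detE u : frame_det u = \det (frame_at 0 u).
Proof. by rewrite /frame_at scale0r addr0. Qed.

Lemma C1_frame_det : C1_on U frame_det.
Proof.
rewrite (_ : frame_det = fun u => \det (frame_at 0 u)).
  by apply: (C1_det oU) => a b; exact: C1_frame_at.
by apply/funext => u; exact: frame_detE.
Qed.

(** [frame_det] is continuous without zeros on the segment from 0 to [u], so it cannot change
    sign. *)
Lemma sg_frame_det u : C u -> Num.sg (frame_det u) = Num.sg (frame_det 0).
Proof.
move=> Cu; pose f (s : R) : R := frame_det (s *: u).
have inC s : s \in `[0, 1] -> C (s *: u).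
  rewrite in_itv/= => /andP[s0 s1]; move: Cu.
  rewrite /closed_unit_ball/= !enorm_le1 dotZl dotZr => u1.
  have := dot_ge0 u; move: (dot u u) u1 => d d1 d0.
  have : s * d <= d by rewrite ler_piMl.
  have : s * (s * d) <= s * d by rewrite ler_piMl// mulr_ge0.
  lra.
have cf : {within `[0, 1], continuous f}.
  apply: continuous_in_subspaceT => s /[!inE] /= s01.
  apply: (@continuous_comp _ _ _ (fun s : R => s *: u) frame_det).
    exact: scalel_continuous.
  exact: (C1_continuous C1_frame_det (CU (inC s s01))).
have f0 : f 0 = frame_det 0 := congr1 frame_det (scale0r u).
have f1 : f 1 = frame_det u := congr1 frame_det (scale1r u).
have fn0 s : s \in `[0, 1] -> f s != 0 by move=> /inC; exact: frame_det_neq0.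
clearbody f; move: (sg_continuous_neq0 cf fn0); rewrite f0 f1.
by [].
Qed.

Lemma sqrt_det_metric u : C u ->
  Num.sqrt (\det (metric x u)) = Num.sg (frame_det 0) * frame_det u.
Proof.
by move=> Cu; rewrite -frame_det_sqr// sqrtr_sqr -(sg_frame_det Cu) normrEsg.
Qed.

Lemma capillary_minkowski k : (1 <= k <= n)%N ->
  surface_integral x (fun u => mean_curvature x nu k.-1 u * weight u) =
  surface_integral x (fun u => mean_curvature x nu k u * support_normal u).
Proof.
(* From here [k] is one less than in the statement: the coefficient of t^k relates H_k to
   H_(k+1). *)
case: k => // k /= kn.
have mB := @measurable_ball_tuples R n.
set eps := Num.sg (frame_det 0).
pose f1 u := weight u * (frame_poly u)`_k.
pose f2 u := support_normal u * (frame_poly u)`_k.+1.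
have i1 : (leb n).-integrable (@ball_tuples R n) (EFin \o (f1 \o row_of)).
  apply: integrable_continuous_ball => u Cu.
  exact: (C1_continuous (C1_M oU C1_weight (C1_coef_frame_poly k)) (CU Cu)).
have i2 : (leb n).-integrable (@ball_tuples R n) (EFin \o (f2 \o row_of)).
  apply: integrable_continuous_ball => u Cu.
  exact: (C1_continuous (C1_M oU C1_support_normal (C1_coef_frame_poly k.+1)) (CU Cu)).
(* The area element is [eps * frame_det], and [frame_det] times [sigma] is a coefficient of q. *)
transitivity (\int[leb n]_(t in @ball_tuples R n) ((eps / 'C(n, k)%:R) * (f1 \o row_of) t)).
  apply: eq_Rintegral => t /[!inE] Ct; rewrite (sqrt_det_metric Ct) /= /f1 (coef_frame_poly _ Ct).
  by rewrite /mean_curvature -/eps; ring.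
transitivity (\int[leb n]_(t in @ball_tuples R n) ((eps / 'C(n, k.+1)%:R) * (f2 \o row_of) t));
    last first.
  apply: eq_Rintegral => t /[!inE] Ct; rewrite (sqrt_det_metric Ct) /= /f2 (coef_frame_poly _ Ct).
  by rewrite /mean_curvature -/eps; ring.
rewrite !RintegralZl//.
have := integral_coef_divergence_poly (Ordinal kn).
rewrite (_ : (fun t => _) = (fun t => ((n%:R - k%:R) * (f1 \o row_of) t - k.+1%:R * (f2 \o
    row_of) t))); last first.
  by apply/funext => t; exact: coef_divergence_poly.
have j1 : (leb n).-integrable (@ball_tuples R n)
    (EFin \o (fun t => (n%:R - k%:R) * (f1 \o row_of) t)).
  exact: (integrableZl mB (n%:R - k%:R) i1).
have j2 : (leb n).-integrable (@ball_tuples R n)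
    (EFin \o (fun t => k.+1%:R * (f2 \o row_of) t)).
  exact: (integrableZl mB k.+1%:R i2).
rewrite (RintegralB mB j1 j2).
rewrite !RintegralZl//; move: (Rintegral _ _ _) (Rintegral _ _ _) => I1 I2.
have c0 : 'C(n, k)%:R != 0 :> R by rewrite pnatr_eq0 -lt0n bin_gt0 ltnW.
have c1 : 'C(n, k.+1)%:R != 0 :> R by rewrite pnatr_eq0 -lt0n bin_gt0.
have binE : (n%:R - k%:R) * 'C(n, k)%:R = k.+1%:R * 'C(n, k.+1)%:R :> R.
  by rewrite -natrB 1?ltnW// -!natrM mul_bin_left.
move=> /subr0_eq E.
(* The sign [eps] is common to both sides. The multiplier also equals (n - k) C(n, k) by [binE], so
   it clears both binomial denominators and leaves the relation [E]. *)
rewrite -!mulrA; congr (_ * _); apply: (mulfI (x := k.+1%:R * 'C(n, k.+1)%:R)).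
  by rewrite mulf_neq0// pnatr_eq0.
by rewrite -[in LHS]binE -[LHS]mulrA (mulVKf c0) E -[RHS]mulrA (mulVKf c1).
Qed.

End flux_field.
End surface.

Theorem proposition2p8 (R : realType) (n k : nat) (theta : R)
    (x nu : 'rV[R]_n -> 'rV[R]_n.+1) (e : 'rV[R]_n.+1)
    (n_ge2 : (2 <= n)%N) (theta_range : 0 < theta < pi)
    (x_proper : properly_embedded x)
    (nu_normal : unit_normal_field x nu)
    (x_capillary : capillary_boundary x nu theta)
    (e_unit : enorm e = 1)
    (k_range : (1 <= k <= n)%N) :
  surface_integral x (fun u =>
    mean_curvature x nu k.-1 u * (dot (x u) e + cos theta * dot (nu u) e)) =
  surface_integral x (fun u =>
    mean_curvature x nu k u * dot (conformal_field e (x u)) (nu u)).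
Proof.
have [[[U1 oU1 [CU1 sx1]] x_rank _] _ x_sphere] := x_proper.
have [[U2 oU2 [CU2 sn2]] nuP] := nu_normal.
have oU : open (U1 `&` U2) by exact: openI.
have CU : closed_unit_ball R n `<=` U1 `&` U2.
  by move=> u Cu; split; [exact: CU1|exact: CU2].
have sx : smooth_on (U1 `&` U2) x by move=> s u [Uu _]; exact: sx1.
have sn : smooth_on (U1 `&` U2) nu by move=> s u [_ Uu]; exact: sn2.
apply: (capillary_minkowski oU CU sx sn nuP x_rank e (c := cos theta) _ _ _ k_range).
- move=> u /dot_eq1 u1; apply: enorm_eq1.
  by apply: (x_sphere (x u)); exists u.
- by move=> u /dot_eq1; exact: x_capillary.
- have s0 : 0 < sin theta by exact: sin_gt0_pi.
  by rewrite -[ltRHS](cos2Dsin2 theta) ltrDl exprn_gt0.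
Qed.
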